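(* For positive integers $n,k$, let $I(n,k)$ be the number of intersecting families $\mathcal F\subseteq\binom{[n]}{k}$, and let $I(n,k,\ge 1)$ be the number of intersecting families $\mathcal F\subseteq\binom{[n]}{k}$ with diversity $\gamma(\mathcal F)\ge 1$ (i.e. non-trivial intersecting families). Then for every $\varepsilon>0$ there exists $K$ such that for all $k\ge K$ and all integers $n\ge 2k+2+2\sqrt{k\log k}$, $$\left|\frac{I(n,k)}{2^{\binom{n-1}{k-1}}}-n\right|\le\varepsilon \qquad\text{and}\qquad \left|\frac{I(n,k,\ge1)}{n\binom{n-1}{k}\,2^{\binom{n-1}{k-1}-\binom{n-k-1}{k-1}}}-1\right|\le\varepsilon .$$ That is, $I(n,k)=(n+o(1))2^{\binom{n-1}{k-1}}$ and $I(n,k,\ge1)=(1+o(1))\,n\binom{n-1}{k}2^{\binom{n-1}{k-1}-\binom{n-k-1}{k-1}}$ as $k\to\infty$.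
   Context: $[n]=\{1,\dots,n\}$ and $\binom{[n]}{k}$ is the set of $k$-element subsets of $[n]$. A family $\mathcal F\subseteq\binom{[n]}{k}$ is intersecting if $F\cap F'\neq\emptyset$ for all $F,F'\in\mathcal F$ (the empty family counts as intersecting). The diversity of $\mathcal F$ is $\gamma(\mathcal F)=|\mathcal F|-\Delta(\mathcal F)$, where $\Delta(\mathcal F)=\max_{i\in[n]}|\{F\in\mathcal F: i\in F\}|$. An intersecting family is non-trivial if $\bigcap_{F\in\mathcal F}F=\emptyset$, equivalently $\gamma(\mathcal F)\ge1$. $\log$ denotes the natural logarithm. *)

(* Defs.v *)
From mathcomp Require Import all_boot all_order all_algebra.
From mathcomp Require Import reals exp.
Set Implicit Arguments.
Unset Strict Implicit.
Unset Printing Implicit Defensive.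

(* The ground set [n] = {1, ..., n} is rendered as 'I_n = {0, ..., n-1}. *)
Definition layer (n k : nat) : {set {set 'I_n}} :=
  [set A : {set 'I_n} | #|A| == k].

Definition intersecting (n : nat) (F : {set {set 'I_n}}) : bool :=
  [forall A in F, forall B in F, A :&: B != set0].

Definition max_degree (n : nat) (F : {set {set 'I_n}}) : nat :=
  \max_(i < n) #|[set A in F | i \in A]|.

(* The truncated subtraction is exact: every degree is at most #|F|. *)
Definition diversity (n : nat) (F : {set {set 'I_n}}) : nat :=
  #|F| - max_degree F.

Definition num_intersecting (n k : nat) : nat :=
  #|[set F : {set {set 'I_n}} | (F \subset layer n k) && intersecting F]|.

Definition num_intersecting_div_ge (n k s : nat) : nat :=
  #|[set F : {set {set 'I_n}} |
      [&& F \subset layer n k, intersecting F & s <= diversity F]]|.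

(* Main.v *)
Require Import Defs.
From mathcomp Require Import all_boot all_order all_algebra.
From mathcomp Require Import reals exp.
From mathcomp Require Import fingroup perm sequences.
From mathcomp Require Import zify ring lra.
Import Order.TTheory GRing.Theory Num.Theory.
Set Implicit Arguments.
Unset Strict Implicit.
Unset Printing Implicit Defensive.

(* Fix a vertex [e] and split an intersecting family [F] into the sets avoiding [e]
   (their number is the codegree of [e]) and the sets containing [e]. The latter must
   miss the "avoiders": the (k-1)-sets disjoint from some member of the former. Hence,
   with N = C(n-1,k-1), a fixed nonempty family [G] of sets avoiding [e] extends in
   2^(N - #avoiders) ways. A single set has t = C(n-k-1,k-1) avoiders, which yields the
   main term; if 2 <= #G <= C(n-1-u,k-u), Kruskal-Katona gives at least t + 2n #G avoiders,
   so such [G] contribute a negligible amount. Families in which every codegree is at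
   least C(n-1-u,k-u) are few, because they are much smaller than a star. Indeed, shifting
   either reaches a stable family, in which every ballot walk of a set avoiding the first
   point becomes positive (which makes the avoiders outnumber the sets themselves by a
   factor (n-k-1)/(k-1)), or at some step it makes a codegree drop below the threshold,
   in which case two large cross-intersecting families of (k-1)-sets appear. There are
   at most 2^(n C(2k,k)) maximal intersecting families by the Bollobás set-pair inequality,
   and the loss in size beats this exponent. The choice u = 6q with q = sqrt(k log k)/4
   makes all the numerical requirements hold. *)

(** * Kruskal-Katona *)

Lemma sum_degrees (T : finType) (G : {set {set T}}) :
  \sum_(v : T) #|[set A in G | v \in A]| = \sum_(A in G) #|A|.
Proof.
under eq_bigr => v _ do rewrite -sum1_card big_mkcond /=.
rewrite exchange_big [RHS]big_mkcond /=; apply: eq_bigr => A _.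
case: ifP => AG; last first.
  by rewrite big1 // => v _; rewrite inE AG.
rewrite -sum1_card [RHS]big_mkcond /=; apply: eq_bigr => v _.
by rewrite inE AG.
Qed.

Lemma sum_degrees_uniform (T : finType) (r : nat) (G : {set {set T}}) :
  (forall A, A \in G -> #|A| = r) ->
  \sum_(v : T) #|[set A in G | v \in A]| = r * #|G|.
Proof.
by move=> Gr; rewrite sum_degrees (eq_bigr (fun=> r)) // sum_nat_const mulnC.
Qed.

Lemma setD1_inj_in (T : finType) (v : T) (G : {set {set T}}) :
  {in [set A in G | v \in A] &, injective (fun A => A :\ v)}.
Proof.
move=> A B; rewrite !inE => /andP[_ vA] /andP[_ vB] AB.
by rewrite -(setD1K vA) -(setD1K vB) AB.
Qed.

(* Keevash's argument for the Lovász form of Kruskal-Katona, linearised so that [x] stays an integer. *)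
Lemma clique_bound (T : finType) (r x : nat) (G K : {set {set T}}) :
  0 < r -> (forall A, A \in G -> #|A| = r) ->
  (forall B, B \in K -> #|B| = r.+1) ->
  (forall B v, B \in K -> v \in B -> B :\ v \in G) ->
  #|G| <= 'C(x, r) -> r.+1 * #|K| <= (x - r) * #|G|.
Proof.
case: r => // r _; elim: r x G K => [|r IH] x G K Gr Kr KG Gx.
all: set Gd := fun v => [set A in G | v \in A].
all: set Kd := fun v => [set B in K | v \in B].
(* Deleting [v] sends the members of [K] through [v] injectively to members of [G] that avoid
   [v]. *)
all: have deg v : #|Kd v| + #|Gd v| <= #|G|
  by rewrite -(card_in_imset (@setD1_inj_in _ v K))
    -(cardsID [set A : {set T} | v \in A] G) addnC leq_add //;
    apply: subset_leq_card; apply/subsetP => A;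
    [rewrite !inE | case/imsetP => B; rewrite !inE => /andP[BK vB] ->;
      rewrite !inE eqxx /= KG].
- suff loc v : #|Kd v| <= (x - 1) * #|Gd v|.
    have := leq_sum (index_enum T) (P := xpredT) (fun v _ => loc v).
    by rewrite -big_distrr /= (sum_degrees_uniform Kr) (sum_degrees_uniform Gr) mul1n.
  rewrite bin1 in Gx.
  case: (posnP #|Gd v|) => [G0|Gp]; last by have := deg v; nia.
  rewrite G0 muln0 leqn0 -leqn0 leqNgt; apply/negP => /card_gt0P[B].
  rewrite inE => /andP[BK vB].
  have /card_gt0P[w] : 0 < #|B :\ v|.
    by have := Kr _ BK; rewrite (cardsD1 v B) vB; lia.
  rewrite !inE => /andP[wv wB].
  have : B :\ w \in Gd v by rewrite !inE KG //= eq_sym wv vB.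
  by rewrite (cards0_eq G0) inE.
- suff loc v : r.+2 * #|Kd v| <= (x - r.+2) * #|Gd v|.
    have := leq_sum (index_enum T) (P := xpredT) (fun v _ => loc v).
    rewrite -!big_distrr /= (sum_degrees_uniform Kr) (sum_degrees_uniform Gr).
    by rewrite -[in X in _ -> X](leq_pmul2l (ltn0Sn r.+1)) [X in _ -> _ <= X]mulnCA.
  (* A small link goes to the induction hypothesis with [x.-1]. A large one leaves, by Pascal's
     rule, at most C(x-1,r+2) members of [G] avoiding [v], and [deg] passes this bound to [Kd v]. *)
  case: (leqP #|Gd v| 'C(x.-1, r.+1)) => [small|/ltnW big].
    pose G' := [set A :\ v | A in Gd v]; pose K' := [set B :\ v | B in Kd v].
    have -> : x - r.+2 = x.-1 - r.+1 by lia.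
    rewrite -(card_in_imset (@setD1_inj_in _ v K)).
    rewrite -(card_in_imset (@setD1_inj_in _ v G)) in small *.
    apply: IH => //.
    - move=> ? /imsetP[A]; rewrite inE => /andP[/Gr cA vA] ->; move: cA.
      by rewrite (cardsD1 v A) vA; lia.
    - move=> ? /imsetP[A]; rewrite inE => /andP[/Kr cA vA] ->; move: cA.
      by rewrite (cardsD1 v A) vA; lia.
    - move=> ? w /imsetP[B]; rewrite inE => /andP[BK vB] ->.
      rewrite !inE => /andP[wv wB]; apply/imsetP; exists (B :\ w).
        by rewrite !inE KG //= eq_sym wv.
      by rewrite !setDDl setUC.
  case: x Gx big => [|x] Gx big.
    suff -> : #|Kd v| = 0 by rewrite muln0.
    rewrite bin_small // in Gx; apply/eqP; rewrite -leqn0 -(eqP (_ : #|G| == 0)) -?leqn0 //.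
    by apply: leq_trans (deg v); rewrite leq_addr.
  have := deg v; have := mul_bin_left x r.+1; rewrite binS in Gx; move: Gx big.
  rewrite subSS /= => Gx big mb dv.
  have le : #|Kd v| <= 'C(x, r.+2).
    by rewrite -(leq_add2r #|Gd v|); apply: leq_trans (leq_add (leqnn _) big); apply: leq_trans dv Gx.
  by apply: (@leq_trans (r.+2 * 'C(x, r.+2))); rewrite ?leq_mul2l ?mb ?leq_mul2l ?le ?big ?orbT.
Qed.

(** If [#|S|] exceeds C(x,j), the second argument of the minimum suffices; otherwise [clique_bound]
    applies to [S] and [H], and (x-j)/(j+1) is the ratio of C(x,j+1) to C(x,j). The minimum allows
    iteration without a size hypothesis. *)
Lemma shadow_bound (T : finType) (j x : nat) (H S : {set {set T}}) :
  0 < j -> (forall B, B \in H -> #|B| = j.+1) ->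
  (forall A, A \in S -> #|A| = j) ->
  (forall B v, B \in H -> v \in B -> B :\ v \in S) ->
  'C(x, j) * minn #|H| 'C(x, j.+1) <= 'C(x, j.+1) * #|S|.
Proof.
move=> j0 Hj Sj HS.
have [le|/ltnW ge] := leqP #|S| 'C(x, j); last first.
  by rewrite mulnC leq_mul // geq_minr.
have := clique_bound j0 Sj Hj HS le; have := mul_bin_left x j => mb cb.
apply: leq_trans (leq_mul (leqnn _) (geq_minl _ _)) _.
rewrite -(leq_pmul2l (ltn0Sn j)) mulnCA [X in _ <= X]mulnA mb.
by rewrite [X in _ <= X * _]mulnC -[X in _ <= X]mulnA leq_mul2l cb orbT.
Qed.

(** * Sets disjoint from some member of a family *)

Definition avoiders (T : finType) (V : {set T}) (j : nat) (G : {set {set T}}) :=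
  [set X : {set T} | [&& X \subset V, #|X| == j & [exists A in G, [disjoint A & X]]]].

Lemma avoidersP (T : finType) (V : {set T}) j (G : {set {set T}}) (X : {set T}) :
  reflect [/\ X \subset V, #|X| = j & exists2 A, A \in G & [disjoint A & X]]
    (X \in avoiders V j G).
Proof.
rewrite inE; apply: (iffP and3P) => [[XV /eqP Xj /exists_inP]|[XV /eqP Xj AG]].
  by split.
by split=> //; apply/exists_inP.
Qed.

(* This is Kruskal-Katona: [avoiders V b G] is an iterated shadow of the family of the
   complements in [V] of the members of [G]. *)
Lemma avoiders_bound (T : finType) (V : {set T}) (k b x : nat) (G : {set {set T}}) :
  0 < b -> (forall A, A \in G -> A \subset V) -> (forall A, A \in G -> #|A| = k) ->
  b + k <= #|V| -> #|V| - k <= x ->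
  'C(x, b) * minn #|G| 'C(x, #|V| - k) <= 'C(x, #|V| - k) * #|avoiders V b G|.
Proof.
move=> b0 GV Gk; set a := #|V| - k => bk ax.
have [d da] : exists d, b + d = a by exists (a - b); rewrite /a; lia.
(* The induction descends in [b] from [a], where complementation in [V] embeds [G] into the
   avoiders. *)
elim: d b b0 bk da => [|d IH] b b0 bk da.
  have -> : b = a by lia.
  rewrite leq_mul2l; apply/orP; right; apply: leq_trans (geq_minl _ _) _.
  rewrite -(card_in_imset (_ : {in G &, injective (fun A => V :\: A)})); last first.
    move=> A B AG BG /(congr1 (fun X => V :\: X)).
    by rewrite !setDDr !setDv !set0U !(setIidPr _) ?GV.
  apply/subset_leq_card/subsetP => _ /imsetP[A AG ->].
  apply/avoidersP; split; first exact: subsetDl.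
    by rewrite cardsD (setIidPr _) ?GV // (Gk A).
  exists A => //; rewrite -setI_eq0; apply/eqP/setP => z.
  by rewrite !inE; case: (z \in A).
have step := IH b.+1 isT ltac:(by rewrite /a in da; lia) ltac:(lia).
have sh : 'C(x, b) * minn #|avoiders V b.+1 G| 'C(x, b.+1)
    <= 'C(x, b.+1) * #|avoiders V b G|.
  apply: shadow_bound => //.
  - by move=> B /avoidersP[].
  - by move=> B /avoidersP[].
  - move=> B v /avoidersP[BV Bb [A AG AB]] vB; apply/avoidersP.
    split; first exact: subset_trans (subD1set _ _) BV.
      by move: Bb; rewrite (cardsD1 v B) vB; lia.
    by exists A => //; apply: disjointWr (subD1set _ _) AB.
have xb : 0 < 'C(x, b.+1) by rewrite bin_gt0; lia.
case: (leqP #|avoiders V b.+1 G| 'C(x, b.+1)) => [le|/ltnW ge].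
  rewrite (minn_idPl le) in sh.
  rewrite -(leq_pmul2l xb) mulnCA.
  apply: leq_trans (leq_mul (leqnn _) step) _.
  by rewrite mulnCA [X in _ <= X]mulnCA leq_mul2l sh orbT.
rewrite (minn_idPr ge) [X in X <= _]mulnC leq_pmul2l // in sh.
by rewrite mulnC leq_mul ?geq_minr.
Qed.

Lemma avoiders_small (T : finType) (V : {set T}) (k b x : nat) (G : {set {set T}}) :
  0 < b -> (forall A, A \in G -> A \subset V) -> (forall A, A \in G -> #|A| = k) ->
  b + k <= #|V| -> #|V| - k <= x -> #|G| <= 'C(x, #|V| - k) ->
  'C(x, b) * #|G| <= 'C(x, #|V| - k) * #|avoiders V b G|.
Proof.
move=> b0 GV Gk bk ax le.
by have := avoiders_bound b0 GV Gk bk ax; rewrite (minn_idPl le).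
Qed.

Lemma avoiders_large (T : finType) (V : {set T}) (k b x : nat) (G : {set {set T}}) :
  0 < b -> (forall A, A \in G -> A \subset V) -> (forall A, A \in G -> #|A| = k) ->
  b + k <= #|V| -> #|V| - k <= x -> 'C(x, #|V| - k) <= #|G| ->
  'C(x, b) <= #|avoiders V b G|.
Proof.
move=> b0 GV Gk bk ax le.
have := avoiders_bound b0 GV Gk bk ax; rewrite (minn_idPr le) mulnC leq_pmul2l //.
by rewrite bin_gt0.
Qed.

Lemma card_family_le (T : finType) (V : {set T}) (k : nat) (G : {set {set T}}) :
  (forall A, A \in G -> A \subset V) -> (forall A, A \in G -> #|A| = k) ->
  #|G| <= 'C(#|V|, k).
Proof.
move=> GV Gk; rewrite -cards_draws; apply/subset_leq_card/subsetP => A AG.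
by rewrite inE GV //= Gk.
Qed.

(** No member of [H] is an avoider of [G], and both kinds are [b]-subsets of [V]. *)
Lemma cross_intersecting_bound (T : finType) (V : {set T}) (b : nat) (G H : {set {set T}}) :
  (forall B, B \in H -> B \subset V) -> (forall B, B \in H -> #|B| = b) ->
  (forall A B, A \in G -> B \in H -> A :&: B != set0) ->
  #|H| + #|avoiders V b G| <= 'C(#|V|, b).
Proof.
move=> HV Hb cross.
have dis : H :&: avoiders V b G = set0.
  apply/eqP; rewrite setI_eq0; apply/pred0P => X /=; apply/negP.
  case/andP=> XH /avoidersP[_ _ [A AG]]; rewrite -setI_eq0.
  by apply/negP/cross.
rewrite -cardsUI dis cards0 addn0.
apply: card_family_le => X; rewrite inE => /orP[XH|/avoidersP[]//]; [exact: HV|exact: Hb].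
Qed.

(** With [x = #|V|] the size hypothesis of [avoiders_small] is automatic; the result is the local
    LYM inequality (normalised matching). *)
Lemma avoiders_LYM (T : finType) (V : {set T}) (k b : nat) (G : {set {set T}}) :
  0 < b -> (forall A, A \in G -> A \subset V) -> (forall A, A \in G -> #|A| = k) ->
  b + k <= #|V| ->
  'C(#|V|, b) * #|G| <= 'C(#|V|, k) * #|avoiders V b G|.
Proof.
move=> b0 GV Gk bk.
have := avoiders_small (x := #|V|) b0 GV Gk bk (leq_subr _ _).
by rewrite bin_sub; [apply; apply: card_family_le|lia].
Qed.

Lemma avoiders1 (T : finType) (V A : {set T}) (b : nat) :
  A \subset V -> #|avoiders V b [set A]| = 'C(#|V| - #|A|, b).
Proof.
move=> AV; rewrite -[in RHS](setIidPr AV) -cardsD -cards_draws; apply: eq_card => X.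
rewrite !inE subsetD; case: (X \subset V) => //=; rewrite andbC; congr (_ && _).
apply/exists_inP/idP => [[_ /set1P->]|dis]; first by rewrite disjoint_sym.
by exists A; rewrite ?set11 // disjoint_sym.
Qed.

(** For [x] in [A] but not in [B], the [b]-sets that contain [x] and miss [B] are avoiders of [B]
    but not of [A]; they supply the second term. *)
Lemma avoiders_pair (T : finType) (V : {set T}) (k b : nat) (G : {set {set T}}) :
  0 < b -> (forall A, A \in G -> A \subset V) -> (forall A, A \in G -> #|A| = k) ->
  1 < #|G| ->
  'C(#|V| - k, b) + 'C((#|V| - k).-1, b.-1) <= #|avoiders V b G|.
Proof.
move=> b0 GV Gk /card_gt1P[A [B [AG BG neqAB]]].
have [x xA xB] : exists2 x, x \in A & x \notin B.
  apply/subsetPn; apply: contra neqAB => sAB.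
  by rewrite eqEcard sAB (Gk A) ?(Gk B) ?leqnn.
pose P := avoiders V b [set A].
pose Q := [set x |: Y | Y in [set Y : {set T} | Y \subset (V :\: B) :\ x & #|Y| == b.-1]].
have cQ : #|Q| = 'C((#|V| - k).-1, b.-1).
  rewrite card_in_imset => [|Y Z]; last first.
    rewrite !inE => /andP[/subsetD1P[_ xY] _] /andP[/subsetD1P[_ xZ] _] YZ.
    by rewrite -(setU1K xY) -(setU1K xZ) YZ.
  rewrite cards_draws; congr 'C(_, _).
  have := cardsD1 x (V :\: B); rewrite inE xB (subsetP (GV A AG)) // => /= e.
  by have := cardsD V B; rewrite (setIidPr _) ?GV // (Gk B); lia.
rewrite -[k in 'C(_ - k, b)](Gk _ AG) -avoiders1 ?GV // -cQ -cardsUI.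
have -> : P :&: Q = set0.
  apply/eqP; rewrite setI_eq0; apply/pred0P => X /=; apply/negP.
  case/andP=> /avoidersP[_ _ [_ /set1P->]] /disjointFr/(_ xA) xX.
  by case/imsetP=> Y _ eX; rewrite eX setU11 in xX.
rewrite cards0 addn0; apply/subset_leq_card/subsetP => X.
rewrite inE => /orP[/avoidersP[XV Xb [_ /set1P-> AX]]|/imsetP[Y]].
  by apply/avoidersP; split=> //; exists A.
rewrite inE => /andP[/subsetD1P[YVB xY] /eqP Yb] ->; apply/avoidersP.
move: YVB; rewrite subsetD => /andP[YV YB]; split.
- by rewrite subUset sub1set YV (subsetP (GV A AG)).
- by rewrite cardsU1 xY Yb; lia.
- exists B => //; rewrite disjoint_sym; apply/pred0P => z /=; rewrite !inE.
  case: eqP => [->|_] /=; first exact: negbTE.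
  by apply/negP => /andP[zY]; rewrite (disjointFr YB zY).
Qed.

(** Either [2 * n * #|G|] is at most the second term of [avoiders_pair], or it exceeds it; since
    (n-k-1) t' = (k-1) t, in that case [t] is itself bounded by a multiple of [#|G|], and
    Kruskal-Katona with the hypothesis on [y] covers both summands. *)
Lemma avoiders_small_family (T : finType) (V : {set T}) (n k y : nat) (G : {set {set T}}) :
  1 < k -> 2 * k <= n -> #|V| = n.-1 ->
  (forall A, A \in G -> A \subset V) -> (forall A, A \in G -> #|A| = k) ->
  n - k.+1 <= y -> 2 * n ^ 2 * 'C(y, n - k.+1) <= k.-1 * 'C(y, k.-1) ->
  1 < #|G| -> #|G| <= 'C(y, n - k.+1) ->
  'C(n - k.+1, k.-1) + 2 * n * #|G| <= #|avoiders V k.-1 G|.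
Proof.
move=> k1 kn cV GV Gk ky ratio G1 Gy.
have e : #|V| - k = n - k.+1 by lia.
have pair := avoiders_pair (_ : 0 < k.-1) GV Gk G1.
have small := avoiders_small (x := y) (_ : 0 < k.-1) GV Gk.
rewrite e in pair small; move: (pair ltac:(lia)) (small ltac:(lia) ltac:(lia) ky Gy) => {pair small}.
set D := #|_|; set g := #|G| in G1 Gy *; set c := 'C(y, n - k.+1) in Gy ratio *.
have c0 : 0 < c by rewrite bin_gt0.
have : (n - k.+1) * 'C((n - k.+1).-1, k.-1.-1) = k.-1 * 'C(n - k.+1, k.-1).
  by rewrite mul_bin_diag prednK //; lia.
set t := 'C(n - k.+1, k.-1); set t' := 'C(_, _) => tt' pair small.
have big : 2 * n ^ 2 * g <= k.-1 * D.
  rewrite -(leq_pmul2l c0) mulnA [c * _]mulnC.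
  apply: leq_trans (leq_mul ratio (leqnn _)) _.
  by rewrite -mulnA [X in _ <= X]mulnCA leq_mul2l small orbT.
case: (leqP (2 * n * g) t') => [le|/ltnW gt].
  by apply: leq_trans pair; rewrite leq_add2l.
rewrite -(leq_pmul2l (_ : 0 < k.-1)); last by lia.
apply: leq_trans big.
rewrite mulnDr -tt'.
apply: (@leq_trans ((n - k.+1) * (2 * n * g) + k.-1 * (2 * n * g))).
  by rewrite leq_add2r leq_mul.
rewrite -mulnDl expnS expn1 -!mulnA mulnCA leq_mul2l /= leq_mul //; lia.
Qed.

(** * Ballot walks and their first hits *)

Definition prefix {n : nat} (m : nat) := [set a : 'I_n | a < m].

Lemma card_prefix (n m : nat) : m <= n -> #|(prefix m : {set 'I_n})| = m.
Proof.
move=> mn; rewrite cardsE -[RHS](card_ord m).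
rewrite -(card_image (f := widen_ord mn)); last by move=> a b [/val_inj].
apply: eq_card => a; apply/idP/imageP => [am|[b _ ->]]; last exact: (ltn_ord b).
by exists (Ordinal (am : a < m)) => //; apply: val_inj.
Qed.

Lemma prefix_count_step (n : nat) (A : {set 'I_n}) (m : nat) : #|A :&: prefix m.+1| <= #|A :&: prefix m|.+1.
Proof.
case: (ltnP m n) => mn; last first.
  rewrite (_ : prefix m.+1 = prefix m :> {set 'I_n}) ?leqnSn //.
  by apply/setP => a; have := ltn_ord a; rewrite !inE; lia.
apply: (@leq_trans #|Ordinal mn |: (A :&: prefix m)|); last first.
  by rewrite cardsU1; case: (_ \notin _).
apply/subset_leq_card/subsetP => a; rewrite !inE => /andP[-> am] /=.
rewrite -(inj_eq val_inj) /=; lia.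
Qed.

(* The ballot walk goes up at the elements of [A] and down elsewhere; [first_hit A] is the first time it is positive. *)
Definition first_hit (n : nat) (A : {set 'I_n}) := find (fun m => m < 2 * #|A :&: prefix m|) (iota 0 n.+1).
Definition hit_prefix (n : nat) (A : {set 'I_n}) := A :&: prefix (first_hit A).

Lemma first_hitP (n : nat) (A : {set 'I_n}) (m : nat) : m <= n -> m < 2 * #|A :&: prefix m| ->
  (forall m', m' < m -> 2 * #|A :&: prefix m'| <= m') -> first_hit A = m.
Proof.
move=> mn hm before; rewrite /first_hit.
set p := (fun m => _); apply/eqP; rewrite eqn_leq; apply/andP; split.
  rewrite leqNgt; apply/negP => /(before_find 0).
  by rewrite nth_iota // add0n /p hm.
rewrite leqNgt; apply/negP => lt.
have /(nth_find 0) : has p (iota 0 n.+1) by apply/hasP; exists m; rewrite ?mem_iota.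
rewrite nth_iota; last by apply: leq_trans lt _; lia.
by rewrite add0n /p ltnNge before.
Qed.

(** The walk moves one unit at a time, so it stands at height exactly 1 when it first becomes
    positive; this is the equation for [first_hit A]. *)
Lemma hit_exists (n : nat) (A : {set 'I_n}) (m : nat) : m <= n -> m < 2 * #|A :&: prefix m| ->
  [/\ first_hit A <= n, (first_hit A).+1 = 2 * #|hit_prefix A| &
   forall m', m' < first_hit A -> 2 * #|A :&: prefix m'| <= m'].
Proof.
move=> mn hm; pose P m := (m <= n) && (m < 2 * #|A :&: prefix m|).
have exP : exists m, P m by exists m; rewrite /P mn.
case: (ex_minnP exP) => f /andP[fn hf] min.
have before m' : m' < f -> 2 * #|A :&: prefix m'| <= m'.
  move=> lt; rewrite leqNgt; apply/negP => h.
  by have := min m'; rewrite /P h (leq_trans (ltnW lt) fn) => /(_ isT); rewrite leqNgt lt.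
rewrite /hit_prefix (first_hitP fn hf before); split=> //.
case: f hf before {min fn} => [|f] hf before; last first.
  by have := before f (ltnSn f); have := prefix_count_step A f; lia.
by rewrite (_ : prefix 0 = set0 :> {set 'I_n}) ?setI0 ?cards0 // in hf *; apply/setP => a; rewrite !inE.
Qed.


(* Cut each set at its first hit: if [E] is the part before the cut, the sets with the same
   [E] are handled by the local LYM inequality after the cut. The complement of an avoider
   built from [E] first hits at the same time, so different [E] give different avoiders. *)
Lemma avoiders_hit (n k : nat) (G : {set {set 'I_n}}) :
  0 < k -> 2 * k <= n ->
  (forall A, A \in G -> #|A| = k) ->
  (forall A a, A \in G -> a \in A -> 0 < (a : nat)) ->
  (forall A, A \in G -> exists2 m, m <= n & m < 2 * #|A :&: prefix m|) ->
  (n - k.+1) * #|G| <= k.-1 * #|avoiders [set a : 'I_n | 0 < a] k.-1 G|.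
Proof.
move=> k0 kn Gk Gpos Ghit; set V := [set a : 'I_n | 0 < a]; set D := avoiders _ _ _.
have partG : #|G| = \sum_(E : {set 'I_n}) #|[set A in G | hit_prefix A == E]|.
  rewrite -sum1_card (partition_big (@hit_prefix n) xpredT) //=.
  by apply: eq_bigr => E _; rewrite -sum1_card; apply: eq_bigl => A; rewrite inE.
have partD : #|D| = \sum_(E : {set 'I_n}) #|[set X in D | hit_prefix (V :\: X) == E]|.
  rewrite -sum1_card (partition_big (fun X => hit_prefix (V :\: X)) xpredT) //=.
  by apply: eq_bigr => E _; rewrite -sum1_card; apply: eq_bigl => A; rewrite inE.
rewrite partG partD !big_distrr; apply: leq_sum => E _ /=.
set GE := [set A in G | _]; set DE := [set X in D | _].
have [->|[A0]] := set_0Vmem GE; first by rewrite cards0 muln0.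
rewrite inE => /andP[A0G /eqP eE].
have [m0 m0n hm0] := Ghit _ A0G.
have := hit_exists m0n hm0; rewrite eE => -[]; set m := first_hit A0; set l := #|E|.
move=> mn ml before.
have EA0 : E = A0 :&: prefix m by rewrite -eE.
have mh : m < 2 * #|A0 :&: prefix m| by rewrite -EA0 -/l; lia.
have GV A : A \in G -> A \subset V.
  by move=> AG; apply/subsetP => a aA; rewrite inE (Gpos A).
have cP0 : #|V :&: prefix m| = m.-1.
  have m0' : 0 < n by apply: leq_trans mn; lia.
  pose z := Ordinal m0'.
  have := cardsD1 z (prefix m : {set 'I_n}); rewrite card_prefix // inE /=.
  have -> : prefix m :\ z = V :&: prefix m.
    by apply/setP => a; rewrite !inE -(inj_eq val_inj) /= lt0n.
  lia.
have EV : E \subset V :&: prefix m by rewrite EA0 setSI ?GV.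
(* The [l] points of [E] lie among the [m.-1 = 2 * l - 2] points of [V] in the prefix. *)
have l2 : 1 < l by have := subset_leq_card EV; rewrite cP0 -/l; lia.
have lk : l <= k by rewrite -(Gk _ A0G) /l EA0 subset_leq_card ?subsetIl.
have fiber A : A \in GE -> [/\ A \in G, #|A| = k & A :&: prefix m = E].
  rewrite inE => /andP[AG /eqP hE]; split=> //; first exact: Gk.
  have [m1 m1n hm1] := Ghit _ AG.
  have [_ + _] := hit_exists m1n hm1; rewrite hE -/l -ml => -[mA].
  by rewrite -hE /hit_prefix mA.
pose S := ~: (prefix m : {set 'I_n}).
have cS : #|S| = n - m by rewrite cardsCs setCK card_ord card_prefix.
pose DD := [set A :&: S | A in GE].
have cDD : #|DD| = #|GE|.
  apply: card_in_imset => A B /fiber[_ _ hA] /fiber[_ _ hB] AB.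
  by rewrite -(setID A (prefix m)) -(setID B (prefix m)) hA hB !setDE AB.
have DDS B : B \in DD -> B \subset S by case/imsetP=> A _ ->; apply: subsetIr.
have DDk B : B \in DD -> #|B| = k - l.
  case/imsetP=> A /fiber[_ cA hA] ->.
  by have := cardsID (prefix m) A; rewrite setDE hA cA -/l -/S => <-; rewrite addKn.
(* The part of [V :&: prefix m] outside [E] has [l - 2] points, so [k - l + 1] further points
   complete a set of size [k.-1]. *)
have := avoiders_LYM (b := k - l + 1) _ DDS DDk.
rewrite cDD cS => /(_ ltac:(lia) ltac:(lia)).
set DA := avoiders _ _ _ => LYM.
have inj : #|DA| <= #|DE|.
  rewrite -(card_in_imset (_ : {in DA &, injective (fun Y => (V :&: prefix m :\: E) :|: Y)})).
    apply/subset_leq_card/subsetP => _ /imsetP[Y /avoidersP[YS cY [_ /imsetP[A AGE ->] AY]] ->].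
    have [AG _ hA] := fiber _ AGE.
    set X := _ :|: Y.
    have YV : Y \subset V.
      apply/subsetP => a /(subsetP YS); rewrite !inE -leqNgt; lia.
    have pre m' : m' <= m -> (V :\: X) :&: prefix m' = A0 :&: prefix m'.
      move=> le; apply/setP => a; rewrite !inE; case: (ltnP a m') => am; last by rewrite !andbF.
      have aY : a \notin Y by apply/negP => /(subsetP YS); rewrite !inE (leq_trans am le).
      have am' : a < m := leq_trans am le.
      rewrite EA0 !inE am' !andbT.
      rewrite (negbTE aY) orbF negb_and negbK.
      case: (boolP (a \in A0)) => [/(Gpos _ _ A0G) ->//|_] /=.
      by case: (0 < a).
    rewrite inE; apply/andP; split.
      apply/avoidersP; split.
      - by rewrite subUset YV andbT; apply: subset_trans (subsetDl _ _) (subsetIl _ _).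
      - rewrite cardsU cardsD cP0 (setIidPr EV) -/l cY.
        have -> : (V :&: prefix m :\: E) :&: Y = set0.
          apply/setP => a; rewrite !inE; apply/negP => /andP[/andP[_ /andP[_ am]] /(subsetP YS)].
          by rewrite !inE am.
        by rewrite cards0; lia.
      - exists A => //; apply/pred0P => a /=; rewrite !inE; apply/negP => /andP[aA].
        case/orP=> [/andP[aE /andP[_ am]]|aY].
          by move: aE; rewrite -hA !inE aA am.
        by have := disjointFl AY aY; rewrite !inE aA -leqNgt; have := subsetP YS _ aY; rewrite !inE -leqNgt => ->.
    have fh : first_hit (V :\: X) = m.
      apply: first_hitP => // [|m' lt]; first by rewrite pre.
      by rewrite pre ?before // ltnW.
    by rewrite /hit_prefix fh pre // -EA0.
  move=> Y Z /avoidersP[YS _ _] /avoidersP[ZS _ _] /(congr1 (fun X => X :&: S)).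
  have H0 : (V :&: prefix m :\: E) :&: S = set0.
    by apply/setP => a; rewrite !inE; case: (a < m); rewrite ?andbF.
  by rewrite !setIUl H0 !set0U !(setIidPl _).
have cb := mul_bin_left (n - m) (k - l).
rewrite -addn1 in cb.
have c0 : 0 < 'C(n - m, k - l) by rewrite bin_gt0; lia.
have key : (n - m - (k - l)) * #|GE| <= (k - l + 1) * #|DA|.
  rewrite -(leq_pmul2l c0) mulnA [_ * (n - m - _)]mulnC -cb -mulnA [X in _ <= X]mulnCA.
  by rewrite leq_mul2l LYM orbT.
have p0 : 0 < n - m - (k - l) by lia.
rewrite -(leq_pmul2l p0) mulnCA.
apply: leq_trans (leq_mul (leqnn _) key) _.
(* The local factor (n-k-l+1)/(k-l+1) does not decrease in [l], and at the smallest value l = 2 it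
   equals (n-k-1)/(k-1). *)
apply: (@leq_trans ((k.-1 * (n - m - (k - l))) * #|DA|)).
  by rewrite mulnA leq_mul //; nia.
by rewrite -mulnA mulnCA leq_mul2l leq_mul2l inj !orbT.
Qed.

(** * Set pairs and maximal intersecting families *)

(** Induction on [#|V|]: for each [x] in [V], keep the sets [s] that avoid [x] and delete [x] from
    their partners. Summed over [x], the new weights of a fixed [s] give [#|V|] times its old
    weight. *)
Lemma bollobas_weighted (T : finType) (V : {set T}) (S : {set {set T}})
    (p : {set T} -> {set T}) :
  (forall s, s \in S -> s \subset V) -> (forall s, s \in S -> p s \subset V) ->
  (forall s, s \in S -> [disjoint s & p s]) ->
  (forall s s', s \in S -> s' \in S -> s != s' -> s :&: p s' != set0) ->
  (\sum_(s in S) ('C(#|s| + #|p s|, #|s|)%:R^-1 : rat) <= 1)%R.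
Proof.
have [d] := ubnP #|V|; elim: d V S p => // d IH V S p Vd SV pV dis cross.
(* An empty partner meets nothing, so the crossing condition rules out a second member of [S]. *)
case: (boolP [exists s in S, p s == set0]) => [/exists_inP[s0 s0S /eqP p0]|].
  have -> : S = [set s0].
    apply/setP => s; rewrite inE; apply/idP/eqP => [sS|->//].
    by apply/eqP; apply: contraT => /(cross _ _ sS s0S); rewrite p0 setI0 eqxx.
  by rewrite big_set1 p0 cards0 addn0 binn invr1.
move=> /exists_inPn pne.
have [->|[s0 s0S]] := set_0Vmem S; first by rewrite big_set0.
have V0 : 0 < #|V|.
  have /set0Pn[x xp] := pne _ s0S.
  by apply/card_gt0P; exists x; apply: (subsetP (pV _ s0S)).
rewrite -(ler_pM2l (_ : 0 < #|V|%:R)%R) ?ltr0n // mulr1.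
pose w (s : {set T}) x : rat := ('C(#|s| + #|p s :\ x|, #|s|)%:R^-1)%R.
have IHx x : x \in V -> (\sum_(s in S | x \notin s) w s x <= 1)%R.
  move=> xV; pose Sx := [set s in S | x \notin s].
  rewrite (eq_bigl (mem Sx)); last by move=> s; rewrite /= inE.
  apply: (IH (V :\ x) Sx (fun s => p s :\ x)).
  - by move: Vd; rewrite (cardsD1 x V) xV.
  - by move=> s; rewrite inE subsetD1 => /andP[/SV -> ->].
  - by move=> s; rewrite inE => /andP[/pV sV _]; apply: setSD.
  - by move=> s; rewrite inE => /andP[/dis sd _]; apply: disjointWr sd; apply: subD1set.
  - move=> s s'; rewrite !inE => /andP[sS xs] /andP[s'S _] /(cross _ _ sS s'S).
    case/set0Pn=> z; rewrite inE => /andP[zs zp]; apply/set0Pn; exists z.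
    by rewrite !inE zs zp !andbT; apply: contraNneq xs => <-.
apply: (@le_trans _ _ (\sum_(x in V) \sum_(s in S | x \notin s) w s x)%R); last first.
  apply: le_trans (ler_sum _ IHx) _.
  by rewrite sumr_const -mulr_natl mulr1.
rewrite (exchange_big_dep (mem S)) /=; last by move=> x s _ /andP[].
rewrite mulr_sumr; apply: ler_sum => s sS.
(* Deleting a point of [p s] lowers the size of the partner by one; a point outside both sets
   changes nothing. The total is right because b / C(a+b-1,a) = (a+b) / C(a+b,a). *)
rewrite (bigID (mem (p s))) /=.
set a := #|s|; set b := #|p s|.
have b0 : 0 < b by rewrite card_gt0 pne.
have e1 : (\sum_(x in V | (s \in S) && (x \notin s) && (x \in p s)) w s x
    = b%:R * ('C(a + b.-1, a)%:R^-1))%R.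
  rewrite mulr_natl -sumr_const; apply: eq_big => [x|x].
    rewrite sS /=; case: (boolP (x \in p s)) => [xp|]; rewrite ?andbF //.
    rewrite (subsetP (pV _ sS)) //= (contraTN _ xp) // => xs.
    by rewrite (disjointFr (dis _ sS) xs).
  case/and3P=> _ _ xp; rewrite /w; congr ('C(_ + _, _)%:R^-1)%R.
  by rewrite /b (cardsD1 x (p s)) xp.
have e2 : (\sum_(x in V | (s \in S) && (x \notin s) && (x \notin p s)) w s x
    = (#|V| - (a + b))%:R * ('C(a + b, a)%:R^-1))%R.
  have -> : #|V| - (a + b) = #|V :\: (s :|: p s)|.
    have sub : s :|: p s \subset V by rewrite subUset SV ?pV.
    by rewrite cardsD (setIidPr sub) cardsU (disjoint_setI0 (dis _ sS)) cards0 subn0.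
  rewrite mulr_natl -sumr_const; apply: eq_big => [x|x].
    by rewrite !inE sS negb_or andbC.
  case/and3P=> _ _ xp; rewrite /w; congr ('C(_ + _, _)%:R^-1)%R.
  by rewrite /b (cardsD1 x (p s)) (negbTE xp).
under eq_bigl => x do rewrite -andbA.
rewrite e1.
under [X in (_ + X)%R]eq_bigl => x do rewrite -andbA.
rewrite e2.
have abV : a + b <= #|V|.
  rewrite /a /b -cardsUI (disjoint_setI0 (dis _ sS)) cards0 addn0.
  by rewrite subset_leq_card // subUset SV ?pV.
have := mul_bin_down (a + b) a; rewrite addKn.
have -> : (a + b).-1 = a + b.-1 by lia.
move=> /(congr1 (fun m => m%:R : rat)%R); rewrite !natrM natrD natrB // natrD.
have : ('C(a + b, a)%:R != 0 :> rat)%R by rewrite pnatr_eq0 -lt0n bin_gt0 leq_addr.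
have : ('C(a + b.-1, a)%:R != 0 :> rat)%R by rewrite pnatr_eq0 -lt0n bin_gt0 leq_addr.
move: ('C(_, _)%:R)%R => c' c'0; move: ('C(_, _)%:R)%R => c c0 e.
have -> : (b%:R / c' = (a%:R + b%:R) / c :> rat)%R.
  by apply/eqP; rewrite eqr_div // -e.
by rewrite -mulrDl addrC subrK.
Qed.

Lemma bollobas_uniform (T : finType) (k : nat) (S : {set {set T}}) (p : {set T} -> {set T}) :
  (forall s, s \in S -> #|s| = k) -> (forall s, s \in S -> #|p s| = k) ->
  (forall s, s \in S -> [disjoint s & p s]) ->
  (forall s s', s \in S -> s' \in S -> s != s' -> s :&: p s' != set0) ->
  #|S| <= 'C(2 * k, k).
Proof.
move=> Sk pk dis cross.
have := bollobas_weighted (V := setT) (fun s _ => subsetT s) (fun s _ => subsetT (p s)) dis cross.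
under eq_bigr => s sS do rewrite Sk // pk // addnn -mul2n.
rewrite sumr_const -[(_ *+ #|_|)%R]mulr_natl ler_pdivrMr ?mul1r ?ler_nat //.
by rewrite ltr0n bin_gt0; lia.
Qed.

Lemma card_cover_le (I T : finType) (X : {set T}) (P : pred I) (Y : I -> {set T}) :
  (forall x, x \in X -> exists2 i, P i & x \in Y i) ->
  #|X| <= \sum_(i | P i) #|Y i|.
Proof.
move=> cov; under eq_bigr => i _ do rewrite -sum1_card big_mkcond /=.
rewrite exchange_big -sum1_card [X in X <= _]big_mkcond /=.
apply: leq_sum => x _; case: ifP => // /cov[i Pi xi].
by rewrite (bigD1 i) //= xi.
Qed.

Lemma in_layer n k (A : {set 'I_n}) : (A \in layer n k) = (#|A| == k).
Proof. by rewrite inE. Qed.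

Lemma intersectingP n (F : {set {set 'I_n}}) :
  reflect (forall A B, A \in F -> B \in F -> A :&: B != set0) (intersecting F).
Proof.
apply: (iffP forall_inP) => [h A B AF BF|h A AF]; first exact: (forall_inP (h A AF)).
by apply/forall_inP => B BF; apply: h.
Qed.

(* Padding by sets outside the layer lets tuples of a fixed size stand for all smaller families. *)
Definition generated n k s (t : s.-tuple {set 'I_n}) : {set {set 'I_n}} :=
  [set A in layer n k | [forall B in layer n k, (B \in t) ==> (A :&: B != set0)]].

(* Enlarge [F] to a maximal intersecting family [M] and take a minimal [S] in [M] such that
   only members of [M] meet all of [S]; by minimality each member of [S] has a partner
   disjoint from it alone, so Bollobás' inequality bounds #|S|. *)
Lemma intersecting_generated n k (F : {set {set 'I_n}}) :
  0 < k -> F \subset layer n k -> intersecting F ->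
  exists t : 'C(2 * k, k).-tuple {set 'I_n},
    (F \subset generated k t) && intersecting (generated k t).
Proof.
move=> k0 Fk Fi.
pose P (H : {set {set 'I_n}}) := (H \subset layer n k) && intersecting H.
have [M /maxsetP[/andP[Mk /intersectingP Mi] Mmax] FM] :
  {M | maxset P M & F \subset M} by apply: maxset_exists; rewrite /P Fk.
pose hits (S : {set {set 'I_n}}) := [set A in layer n k | [forall B in S, A :&: B != set0]].
have hM : hits M \subset M.
  apply/subsetP => A; rewrite inE => /andP[Ak /forall_inP AM].
  rewrite -(Mmax (A |: M)) ?setU11 ?subsetU1 // /P subUset sub1set Ak Mk /=.
  have AA : A :&: A != set0 by rewrite setIid -card_gt0; rewrite inE in Ak; rewrite (eqP Ak).
  apply/intersectingP => B C /setU1P[->|BM] /setU1P[->|CM] //.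
  - exact: AM.
  - by rewrite setIC AM.
  - exact: Mi.
have [S /minsetP[SM Smin] SsubM] :
  {S | minset (fun S => hits S \subset M) S & S \subset M} by apply: minset_exists.
have partner s : s \in S -> {A | (A \in layer n k) && [disjoint s & A]
    & [forall s' in S, (s' != s) ==> (s' :&: A != set0)]}.
  move=> sS; apply: sig2W.
  have /subsetPn[A] : ~~ (hits (S :\ s) \subset M).
    apply/negP => /Smin/(_ (subD1set _ _)) eS.
    by move: sS; rewrite -eS !inE eqxx.
  rewrite inE => /andP[Ak /forall_inP AS] AM; exists A.
    rewrite Ak -setI_eq0 setIC; apply: contraT => As.
    case/negP: AM; apply: (subsetP SM); rewrite inE Ak; apply/forall_inP => B BS.
    by case: (eqVneq B s) => [->//|Bs]; apply: AS; rewrite !inE Bs.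
  apply/forall_inP => s' s'S; apply/implyP => ne; rewrite setIC.
  by apply: AS; rewrite !inE ne.
(* The value outside [S] is a mere default. *)
pose p s := if @idP (s \in S) is ReflectT sS then s2val (partner s sS) else set0.
have pP s : s \in S -> [/\ #|p s| = k, [disjoint s & p s] &
    forall s', s' \in S -> s' != s -> s' :&: p s != set0].
  rewrite /p; case: {-}_ / idP => // sS _; case: (partner s sS) => A /= /andP[].
  rewrite inE => /eqP Ak sA /forall_inP h; split=> // s' s'S ne.
  by apply: (implyP (h _ s'S)).
have Sk s : s \in S -> #|s| = k.
  by move=> /(subsetP SsubM)/(subsetP Mk); rewrite inE => /eqP.
have cS : #|S| <= 'C(2 * k, k).
  apply: (bollobas_uniform (p := p)) => // [s /pP[]|s /pP[]|s s' sS s'S ne] //.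
  by have [_ _] := pP _ s'S; apply.
pose l := enum S ++ nseq ('C(2 * k, k) - #|S|) set0.
have szl : size l == 'C(2 * k, k) by rewrite size_cat -cardE size_nseq subnKC.
have gE : generated k (Tuple szl) = M.
  have -> : generated k (Tuple szl) = hits S.
    apply/setP => A; rewrite !inE; congr (_ && _); apply/forall_inP/forall_inP => h B.
      move=> BS; apply: (implyP (h B _)); first by rewrite inE Sk.
      by rewrite mem_cat mem_enum BS.
    rewrite inE => /eqP Bk; apply/implyP; rewrite mem_cat mem_enum => /orP[/h//|].
    by rewrite mem_nseq => /andP[_ /eqP B0]; rewrite B0 cards0 in Bk; rewrite -Bk in k0.
  apply/eqP; rewrite eqEsubset SM; apply/subsetP => A AM.
  rewrite inE (subsetP Mk) //; apply/forall_inP => B /(subsetP SsubM) BM; exact: Mi.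
by exists (Tuple szl); rewrite gE FM; apply/intersectingP.
Qed.

(** For positive [n], the diversity is the minimum of these numbers over [e]. *)
Definition codegree n (F : {set {set 'I_n}}) (e : 'I_n) := #|[set A in F | e \notin A]|.

Lemma codegreeS n (F H : {set {set 'I_n}}) e : F \subset H -> codegree F e <= codegree H e.
Proof.
move=> FH; apply/subset_leq_card/subsetP => A; rewrite !inE => /andP[/(subsetP FH) -> ->].
by [].
Qed.

(** A generated family containing [F] inherits its large codegrees, so the size hypothesis applies
    to it and it has at most 2^m subfamilies. The tuples number 2^(n C(2k,k)). *)
Lemma count_bounded (n k g m : nat) :
  0 < k ->
  (forall F : {set {set 'I_n}}, F \subset layer n k -> intersecting F ->
     (forall e, g <= codegree F e) -> #|F| <= m) ->
  #|[set F : {set {set 'I_n}} |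
      [&& F \subset layer n k, intersecting F & [forall e, g <= codegree F e]]]|
  <= 2 ^ (n * 'C(2 * k, k) + m).
Proof.
move=> k0 bound.
pose good (t : 'C(2 * k, k).-tuple {set 'I_n}) :=
  intersecting (generated k t) && [forall e, g <= codegree (generated k t) e].
apply: (@leq_trans (\sum_(t | good t) #|powerset (generated k t)|)).
  apply: card_cover_le => F; rewrite inE => /and3P[Fk Fi /forallP Fg].
  have [t /andP[Ft ti]] := intersecting_generated k0 Fk Fi; exists t.
    by rewrite /good ti; apply/forallP => e; apply: leq_trans (Fg e) (codegreeS _ Ft).
  by rewrite inE.
apply: (@leq_trans (\sum_(t | good t) 2 ^ m)).
  apply: leq_sum => t /andP[ti /forallP tg]; rewrite card_powerset leq_exp2l //.
  by apply: bound => //; apply/subsetP => A; rewrite inE => /andP[].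
rewrite sum_nat_const expnD leq_mul2r; apply/orP; right.
apply: leq_trans (max_card _) _.
by rewrite card_tuple -cardsT -powersetT card_powerset cardsT card_ord expnM.
Qed.

(** * Shifting *)

Definition swap n (i j : 'I_n) (A : {set 'I_n}) : {set 'I_n} := tperm i j @^-1: A.

Lemma in_swap n (i j : 'I_n) (A : {set 'I_n}) z : (z \in swap i j A) = (tperm i j z \in A).
Proof. by rewrite inE. Qed.

Lemma swapK n (i j : 'I_n) : involutive (swap i j).
Proof. by move=> A; apply/setP => z; rewrite !in_swap tpermK. Qed.

Lemma card_swap n (i j : 'I_n) (A : {set 'I_n}) : #|swap i j A| = #|A|.
Proof. exact/card_preimset/perm_inj. Qed.

(** The usual compression that replaces [j] by [i] unless the result is already present, written as
    a membership test on [A] and its swap. *)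
Definition shift n (i j : 'I_n) (F : {set {set 'I_n}}) : {set {set 'I_n}} :=
  [set A : {set 'I_n} | if (i \in A) && (j \notin A) then (A \in F) || (swap i j A \in F)
           else if (j \in A) && (i \notin A) then (A \in F) && (swap i j A \in F)
           else A \in F].

(** Shifting preserves the number of members in each pair [A], [swap i j A]. Both sums are doubled
    so that fixed points of the swap need no separate treatment. *)
Lemma sum_shift n (i j : 'I_n) (F : {set {set 'I_n}}) (w : {set 'I_n} -> nat) :
  (forall A, w (swap i j A) = w A) ->
  \sum_(A in shift i j F) w A = \sum_(A in F) w A.
Proof.
move=> ws; apply: double_inj; rewrite -!addnn.
have dbl (H : {set {set 'I_n}}) : \sum_(A in H) w A + \sum_(A in H) w A =
    \sum_A ((A \in H) + (swap i j A \in H)) * w A.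
  under [RHS]eq_bigr => A _ do rewrite mulnDl.
  rewrite big_split /=; congr (_ + _).
    by rewrite big_mkcond; apply: eq_bigr => A _; case: (A \in H); rewrite ?mul1n.
  rewrite (reindex_inj (inv_inj (@swapK n i j))) big_mkcond /=.
  by apply: eq_bigr => A _; rewrite ws; case: (_ \in H); rewrite ?mul1n.
rewrite !dbl; apply: eq_bigr => A _; congr (_ * _).
rewrite !inE swapK tpermL tpermR.
case: (i \in A); case: (j \in A) => //=; case: (A \in F); case: (swap i j A \in F) => //.
Qed.

Lemma card_shift n (i j : 'I_n) (F : {set {set 'I_n}}) : #|shift i j F| = #|F|.
Proof. by rewrite -!sum1_card sum_shift. Qed.

Lemma shift_layer n k (i j : 'I_n) (F : {set {set 'I_n}}) : F \subset layer n k -> shift i j F \subset layer n k.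
Proof.
move=> /subsetP Fk; apply/subsetP => A; rewrite inE.
have sw : swap i j A \in F -> A \in layer n k.
  by move=> /Fk; rewrite !in_layer card_swap.
case: ifP => _; first by case/orP => [/Fk|/sw].
by case: ifP => _; [case/andP => /Fk | move/Fk].
Qed.

(** Let [A] be a new member disjoint from [B]. If [j] is in [B], then [swap i j B] is also in [F],
    and the two swaps are disjoint members of [F]; otherwise [B] contains neither [i] nor [j] and so
    misses [swap i j A] too. *)
Lemma shift_intersecting n (i j : 'I_n) (F : {set {set 'I_n}}) : intersecting F -> intersecting (shift i j F).
Proof.
move=> /intersectingP Fi.
have swapI (A B : {set 'I_n}) : A :&: B = set0 -> swap i j A :&: swap i j B = set0.
  by rewrite /swap -preimsetI => ->; rewrite preimset0.
have new (A B : {set 'I_n}) : A \in shift i j F -> B \in shift i j F -> A \notin F -> A :&: B != set0.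
  rewrite !inE => hA hB AF; apply/negP => /eqP dis.
  move: hA; rewrite (negbTE AF) /=; case: ifP => [/andP[iA jA] sA|_]; last by case: ifP.
  have iB : i \notin B by apply/negP => iB; move/setP/(_ i): dis; rewrite !inE iA iB.
  move: hB; rewrite (negbTE iB) /= andbT; case: ifP => [jB /andP[_ sB]|/negbT jB BF].
    by have := Fi _ _ sA sB; rewrite swapI ?eqxx.
  have := Fi _ _ sA BF; case/set0Pn => z; rewrite inE in_swap; case: tpermP => [->|->|_ _].
  - by rewrite (negbTE iB) andbF.
  - by rewrite (negbTE jB) andbF.
  - by move=> zAB; move/setP/(_ z): dis; rewrite !inE zAB.
apply/intersectingP => A B As Bs.
case: (boolP (A \in F)) => AF; last exact: new.
case: (boolP (B \in F)) => BF; last by rewrite setIC new.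
exact: Fi.
Qed.

Lemma codegree_sum n (F : {set {set 'I_n}}) e : codegree F e = \sum_(A in F) (e \notin A).
Proof.
rewrite /codegree -sum1_card [LHS]big_mkcond [RHS]big_mkcond /=.
by apply: eq_bigr => A _; rewrite inE; case: (A \in F) => //; case: (e \in A).
Qed.

Lemma codegree_shift n (i j e : 'I_n) (F : {set {set 'I_n}}) : e != i -> e != j ->
  codegree (shift i j F) e = codegree F e.
Proof.
move=> ei ej; rewrite !codegree_sum sum_shift // => A.
by rewrite in_swap tpermD // eq_sym.
Qed.

Lemma codegree_shift2 n (i j : 'I_n) (F : {set {set 'I_n}}) :
  codegree (shift i j F) i + codegree (shift i j F) j = codegree F i + codegree F j.
Proof.
rewrite !codegree_sum -!big_split /= sum_shift // => A.
by rewrite !in_swap tpermL tpermR addnC.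
Qed.

Lemma avoid_shift n (i j : 'I_n) (F : {set {set 'I_n}}) :
  [set A in F | j \notin A] \subset [set A in shift i j F | j \notin A].
Proof.
apply/subsetP => A; rewrite !inE => /andP[AF jA].
by rewrite AF (negbTE jA) /= !andbT; case: ifP.
Qed.

(** If the walk of [A] never became positive, each point of [A] could be matched with an earlier
    point outside [A], as in a bracketing; the corresponding swaps would produce a member of [F]
    disjoint from [A]. *)
Lemma stable_hit n (F : {set {set 'I_n}}) (A : {set 'I_n}) :
  intersecting F ->
  (forall (i j : 'I_n) B, i < j -> B \in F -> j \in B -> i \notin B -> swap i j B \in F) ->
  A \in F -> exists2 m, m <= n & m < 2 * #|A :&: prefix m|.
Proof.
move=> /intersectingP Fi stable AF.
suff /existsP[m h] : [exists m : 'I_n.+1, m < 2 * #|A :&: prefix m|].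
  by exists m; rewrite // -ltnS.
apply: contraT => /existsPn low.
have {}low m : m <= n -> 2 * #|A :&: prefix m| <= m.
  by rewrite -ltnS => mn; have := low (Ordinal mn); rewrite -leqNgt.
suff [B [BF _ _ dis]] : exists B, [/\ B \in F, #|B| = #|A|,
    forall a : 'I_n, n <= a -> (a \in B) = (a \in A) &
    forall a : 'I_n, a < n -> a \in A -> a \notin B].
  have /set0Pn[a] := Fi _ _ AF BF.
  by rewrite inE => /andP[aA aB]; have := dis a (ltn_ord a) aA; rewrite aB.
suff build m : m <= n -> exists B, [/\ B \in F, #|B| = #|A|,
    forall a : 'I_n, m <= a -> (a \in B) = (a \in A) &
    forall a : 'I_n, a < m -> a \in A -> a \notin B] by exact: build.
elim: m => [|m IH] mn; first by exists A.
have [B [BF cB same dis]] := IH (ltnW mn).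
pose x := Ordinal mn.
case: (boolP (x \in A)) => xA; last first.
  exists B; split=> // [a am|a am aA]; first exact/same/ltnW.
  apply: dis => //; move: am; rewrite ltnS leq_eqVlt => /orP[/eqP e|//].
  have ax : a = x by apply: val_inj.
  by rewrite ax (negbTE xA) in aA.
have pB : #|B :&: prefix m| = #|A :&: prefix m|.
  have := cardsID (prefix m) B; rewrite cB -(cardsID (prefix m) A).
  have -> : B :\: prefix m = A :\: prefix m.
    by apply/setP => a; rewrite !inE -leqNgt; case: leqP => //= /same ->.
  by move/addIn.
have xpre : #|A :&: prefix m| < #|A :&: prefix m.+1|.
  apply: proper_card; rewrite properE; apply/andP; split.
    by apply/setIS/subsetP => a; rewrite !inE => /ltnW.
  by apply/subsetPn; exists x; rewrite !inE xA /= ?ltnn ?ltnSn.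
(* Pigeonhole: as [x] is in [A] and the walk is not positive at [m.+1], the traces of [A] and [B] on
   the prefix together have fewer than [m] points. *)
have [b bm] : exists2 b, b \in (prefix m : {set 'I_n}) & b \notin (A :|: B) :&: prefix m.
  apply/subsetPn; apply/negP => /subset_leq_card.
  rewrite (card_prefix (ltnW mn)) setIUl => /leq_trans/(_ (leq_card_setU _ _)).
  by rewrite pB; have := low _ mn; lia.
rewrite inE bm andbT !inE negb_or => /andP[bA bB].
rewrite inE in bm.
exists (swap b x B); split.
- by apply: stable => //; rewrite same.
- by rewrite card_swap.
- move=> a am; rewrite in_swap tpermD ?same 1?ltnW //.
    by apply: contraTneq am => <-; rewrite -leqNgt ltnW // ltnS ltnW.
  by apply: contraTneq am => <-; rewrite /= ltnn.
- move=> a am aA; rewrite in_swap; case: tpermP => [e|//|ne nx].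
    by rewrite e (negbTE bA) in aA.
  apply: dis => //; move: am; rewrite ltnS leq_eqVlt => /orP[/eqP e|//].
  by case: nx; apply: val_inj.
Qed.

(** * Sizes of families with all codegrees large *)

Lemma bin_pascal n k : 0 < n -> 0 < k -> 'C(n, k) = 'C(n.-1, k) + 'C(n.-1, k.-1).
Proof. by case: n => // n; case: k => // k; rewrite binS. Qed.

Lemma card_supersets n k (S : {set 'I_n}) :
  #|S| <= k -> #|[set A in layer n k | S \subset A]| = 'C(n - #|S|, k - #|S|).
Proof.
move=> Sk; have -> : n - #|S| = #|~: S| by rewrite [RHS]cardsCs setCK card_ord.
rewrite -cards_draws.
rewrite -[LHS](card_in_imset (f := fun A => A :\: S)); last first.
  move=> A B; rewrite !inE => /andP[_ SA] /andP[_ SB] e.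
  by rewrite -(setID A S) -(setID B S) e (setIidPr SA) (setIidPr SB).
apply: eq_card => X; rewrite !inE; apply/imsetP/andP => [[A]|[XS /eqP cX]].
  rewrite !inE => /andP[/eqP cA SA] ->; rewrite setDE subsetIr -setDE cardsD.
  by rewrite (setIidPr SA) cA.
have dis : S :&: X = set0 by apply/eqP; rewrite setI_eq0 disjoint_sym disjoints_subset.
exists (S :|: X).
  by rewrite !inE subsetUl cardsU dis cards0 subn0 cX subnKC ?eqxx.
rewrite setDUl setDv set0U; apply/esym/setDidPl.
by rewrite -setI_eq0 setIC dis.
Qed.

Lemma card_setC1 n (e : 'I_n) : #|[set~ e]| = n.-1.
Proof. by rewrite cardsC1 card_ord. Qed.

(** Deleting [e] from the members containing it gives a family that cross-intersects the members
    avoiding [e]. *)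
Lemma star_split n k (F : {set {set 'I_n}}) (e : 'I_n) :
  0 < k -> F \subset layer n k -> intersecting F ->
  #|F| + #|avoiders [set~ e] k.-1 [set A in F | e \notin A]|
    <= 'C(n.-1, k.-1) + codegree F e.
Proof.
move=> k0 /subsetP Fk /intersectingP Fi.
pose H := [set A :\ e | A in [set A in F | e \in A]].
have cF : #|F| = #|H| + codegree F e.
  rewrite /H card_in_imset; last exact: setD1_inj_in.
  rewrite -(cardsID [set A : {set 'I_n} | e \in A] F) /codegree.
  by congr (_ + _); apply: eq_card => A; rewrite !inE // andbC.
rewrite cF addnAC leq_add2r -(card_setC1 e).
apply: cross_intersecting_bound.
- by move=> ? /imsetP[A _ ->]; rewrite -setTD setSD ?subsetT.
- move=> ? /imsetP[A]; rewrite inE => /andP[/Fk + eA] ->.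
  by rewrite inE (cardsD1 e A) eA => /eqP <-.
- move=> A ? + /imsetP[B + ->]; rewrite !inE => /andP[AF eA] /andP[BF eB].
  have /set0Pn[z] := Fi _ _ AF BF; rewrite inE => /andP[zA zB].
  by apply/set0Pn; exists z; rewrite !inE zA zB !andbT; apply: contraNneq eA => <-.
Qed.

(** Kruskal-Katona with [x = n - 3]: C(n-3,n-k-1) = C(n-3,k-2), and the factor (n-k-1)/(k-1) is the
    ratio of C(n-3,k-1) to it. The size [k'] is [k] or [k.-1], according to whether one or two
    points are removed from the ground set. *)
Lemma avoiders_ratio (T : finType) (V : {set T}) n k k' (G : {set {set T}}) :
  1 < k -> 2 * k <= n -> #|V| - k' = n - k.+1 -> k.-1 + k' <= #|V| ->
  (forall A, A \in G -> A \subset V) -> (forall A, A \in G -> #|A| = k') ->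
  #|G| <= 'C(n - 3, n - k.+1) ->
  (n - k.+1) * #|G| <= k.-1 * #|avoiders V k.-1 G|.
Proof.
move=> k1 kn eV bk GV Gk le.
have := avoiders_small (x := n - 3) (_ : 0 < k.-1) GV Gk bk; rewrite eV.
move=> /(_ ltac:(lia) ltac:(lia) le); set D := #|_|.
have e1 : 'C(n - 3, n - k.+1) = 'C(n - 3, k - 2).
  by rewrite -bin_sub; [congr 'C(_, _)|]; lia.
have := mul_bin_left (n - 3) (k - 2).
rewrite (_ : (k - 2).+1 = k.-1); last by lia.
rewrite (_ : n - 3 - (k - 2) = n - k.+1); last by lia.
rewrite e1 => mb h.
have c0 : 0 < 'C(n - 3, k - 2) by rewrite bin_gt0; lia.
by rewrite -(leq_pmul2l c0) mulnA [_ * (n - _)]mulnC -mb -mulnA [X in _ <= X]mulnCA leq_mul2l h orbT.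
Qed.

(** [B] is the size of one of the families and [D] the number of its avoiders. One of the two
    satisfies the size bound of [avoiders_ratio]: a larger [G] has at least C(n-3,k-1) avoiders,
    which leaves at most C(n-3,k-2) sets for [H]. *)
Lemma cross_pair_bound (T : finType) (V : {set T}) n k z (G H : {set {set T}}) :
  1 < k -> 2 * k < n -> #|V| = n - 2 -> n - k.+1 <= z ->
  (forall A, A \in G -> A \subset V) -> (forall A, A \in G -> #|A| = k.-1) ->
  (forall A, A \in H -> A \subset V) -> (forall A, A \in H -> #|A| = k.-1) ->
  (forall A B, A \in G -> B \in H -> A :&: B != set0) ->
  'C(z, n - k.+1) <= #|G| -> 'C(z, n - k.+1) <= #|H| ->
  exists D B, [/\ #|G| + #|H| + D <= 'C(n - 2, k.-1) + B,
    (n - k.+1) * B <= k.-1 * D & 'C(z, k.-1) <= D].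
Proof.
move=> k1 kn cV az.
have small (G' H' : {set {set T}}) :
  (forall A, A \in G' -> A \subset V) -> (forall A, A \in G' -> #|A| = k.-1) ->
  (forall A, A \in H' -> A \subset V) -> (forall A, A \in H' -> #|A| = k.-1) ->
  (forall A B, A \in G' -> B \in H' -> A :&: B != set0) ->
  'C(z, n - k.+1) <= #|G'| -> #|G'| <= 'C(n - 3, n - k.+1) ->
  exists D B, [/\ #|G'| + #|H'| + D <= 'C(n - 2, k.-1) + B,
    (n - k.+1) * B <= k.-1 * D & 'C(z, k.-1) <= D].
  move=> GV Gk HV Hk cross zG Gs.
  have eV : #|V| - k.-1 = n - k.+1 by lia.
  exists #|avoiders V k.-1 G'|, #|G'|; split.
  - by rewrite -addnA addnC leq_add2r -cV; apply: cross_intersecting_bound.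
  - by apply: (avoiders_ratio (k' := k.-1)) => //; lia.
  - by apply: (avoiders_large (k := k.-1)) => //; rewrite ?eV //; lia.
move=> GV Gk HV Hk cross zG zH.
case: (leqP #|G| 'C(n - 3, n - k.+1)) => [|/ltnW big]; first exact: small.
have eV : #|V| - k.-1 = n - k.+1 by lia.
have Hs : #|H| <= 'C(n - 3, n - k.+1).
  have := cross_intersecting_bound HV Hk cross.
  have := avoiders_large (b := k.-1) (x := n - 3) _ GV Gk; rewrite eV.
  move=> /(_ ltac:(lia) ltac:(lia) ltac:(lia) big).
  have -> : 'C(n - 3, n - k.+1) = 'C(n - 3, k - 2).
    by rewrite -bin_sub; [congr 'C(_, _)|]; lia.
  have := bin_pascal (_ : 0 < n - 2) (_ : 0 < k.-1).
  have -> : (n - 2).-1 = n - 3 by lia.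
  have -> : k.-1.-1 = k - 2 by lia.
  by move=> /(_ ltac:(lia) ltac:(lia)); rewrite cV; lia.
have cross' A B : A \in H -> B \in G -> A :&: B != set0.
  by move=> AH BG; rewrite setIC cross.
by rewrite [#|G| + _]addnC; apply: small.
Qed.

(** If the new codegree at [i] is only moderately small, the shifted family itself is split at [i].
    If it is very small, so is the number of members avoiding both [i] and [j], and the members
    containing exactly one of the two points form a large cross-intersecting pair. *)
Lemma drop_bound n k u (F : {set {set 'I_n}}) (i j : 'I_n) :
  1 < u -> u < k -> 2 * k < n -> i != j ->
  F \subset layer n k -> intersecting F ->
  'C(n - u.+1, n - k.+1) <= codegree F i ->
  'C(n - u.+1, n - k.+1) <= codegree F j ->
  codegree (shift i j F) i < 'C(n - u.+1, n - k.+1) ->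
  exists D B, [/\ #|F| + D <= 'C(n.-1, k.-1) + 'C(n - u.+2, n - k.+1) + B,
    (n - k.+1) * B <= k.-1 * D & 'C(n - u.+2, k.-1) <= D].
Proof.
move=> u1 uk kn ij Fk Fi gi gj drop.
have F'k := shift_layer i j Fk; have F'i := shift_intersecting i j Fi.
set F' := shift i j F in drop F'k F'i.
case: (leqP 'C(n - u.+2, n - k.+1) (codegree F' i)) => [big|small].
  pose G := [set A in F' | i \notin A].
  have GV A : A \in G -> A \subset [set~ i].
    by rewrite inE => /andP[_ iA]; rewrite subsetC sub1set inE.
  have Gk A : A \in G -> #|A| = k.
    by rewrite inE => /andP[/(subsetP F'k) + _]; rewrite inE => /eqP.
  have eV : #|[set~ i]| - k = n - k.+1 by rewrite card_setC1; lia.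
  exists #|avoiders [set~ i] k.-1 G|, #|G|; split.
  - rewrite -(card_shift i j); apply: leq_trans (star_split _ _ F'k F'i) _; first lia.
    by rewrite leq_add2r leq_addr.
  - apply: (avoiders_ratio (k' := k)) => //; rewrite ?card_setC1; try lia.
    by apply: leq_trans (ltnW drop) _; apply: leq_bin2l; lia.
  - by apply: (avoiders_large (k := k)) => //; rewrite ?eV ?card_setC1 //; lia.
pose V := ~: [set i; j].
have cV : #|V| = n - 2 by rewrite cardsCs setCK cards2 ij card_ord.
pose G := [set A :\ i | A in [set A in [set A in F | j \notin A] | i \in A]].
pose H := [set A :\ j | A in [set A in [set A in F | i \notin A] | j \in A]].
pose N := [set A in F | (i \notin A) && (j \notin A)].
have layerF A : A \in F -> #|A| = k by move/(subsetP Fk); rewrite inE => /eqP.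
have cN : #|N| < 'C(n - u.+2, n - k.+1).
  apply: leq_ltn_trans small; apply/subset_leq_card/subsetP => A.
  by rewrite !inE => /and3P[-> /negbTE-> /negbTE->].
have ci : codegree F i = #|H| + #|N|.
  rewrite /H card_in_imset; last exact: setD1_inj_in.
  rewrite /codegree -(cardsID [set A : {set 'I_n} | j \in A]); congr (_ + _).
    by apply: eq_card => A; rewrite !inE.
  by apply: eq_card => A; rewrite !inE; case: (A \in F); rewrite //= ?andbF // andbC.
have cj : codegree F j = #|G| + #|N|.
  rewrite /G card_in_imset; last exact: setD1_inj_in.
  rewrite /codegree -(cardsID [set A : {set 'I_n} | i \in A]); congr (_ + _).
    by apply: eq_card => A; rewrite !inE.
  by apply: eq_card => A; rewrite !inE; case: (A \in F); rewrite //= ?andbF // andbC.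
have cF : #|F| <= 'C(n - 2, k - 2) + (#|G| + #|H|) + #|N|.
  rewrite -(cardsID [set A : {set 'I_n} | i \in A] F).
  have -> : #|F :\: [set A : {set 'I_n} | i \in A]| = #|H| + #|N|.
    by rewrite -ci; apply: eq_card => A; rewrite !inE andbC.
  have -> : #|F :&: [set A : {set 'I_n} | i \in A]| =
      #|[set A in F | (i \in A) && (j \in A)]| + #|G|.
    rewrite /G card_in_imset; last exact: setD1_inj_in.
    rewrite -(cardsID [set A : {set 'I_n} | j \in A]); congr (_ + _).
      by apply: eq_card => A; rewrite !inE andbA.
    by apply: eq_card => A; rewrite !inE andbCA andbA.
  suff : #|[set A in F | (i \in A) && (j \in A)]| <= 'C(n - 2, k - 2) by lia.
  have c2 : #|[set i; j]| = 2 by rewrite cards2 ij.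
  rewrite -{1 2}c2 -card_supersets ?c2 //; last by lia.
  apply/subset_leq_card/subsetP => A; rewrite !inE => /and3P[AF iA jA].
  by rewrite layerF // eqxx subUset !sub1set iA jA.
(* The threshold splits by Pascal's rule into two terms, of which the second is the larger; hence
   removing [N] still leaves [G] and [H] large. *)
have step : 'C(n - u.+1, n - k.+1) =
    'C(n - u.+2, n - k.+1) + 'C(n - u.+2, n - k.+2).
  have := bin_pascal (_ : 0 < n - u.+1) (_ : 0 < n - k.+1).
  have -> : (n - u.+1).-1 = n - u.+2 by lia.
  have -> : (n - k.+1).-1 = n - k.+2 by lia.
  by apply; lia.
have low : 'C(n - u.+2, n - k.+1) <= 'C(n - u.+2, n - k.+2).
  have := mul_bin_left (n - u.+2) (n - k.+2).
  rewrite (_ : (n - k.+2).+1 = n - k.+1); last by lia.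
  move=> e; rewrite -(leq_pmul2l (_ : 0 < n - k.+1)) ?e ?leq_mul //; lia.
have zG : 'C(n - u.+2, n - k.+1) <= #|G|.
  rewrite -(leq_add2r #|N|) -cj; apply: leq_trans gj.
  by rewrite step addnC leq_add // ltnW.
have zH : 'C(n - u.+2, n - k.+1) <= #|H|.
  rewrite -(leq_add2r #|N|) -ci; apply: leq_trans gi.
  by rewrite step addnC leq_add // ltnW.
suff [D [B [h1 h2 h3]]] : exists D B, [/\ #|G| + #|H| + D <= 'C(n - 2, k.-1) + B,
    (n - k.+1) * B <= k.-1 * D & 'C(n - u.+2, k.-1) <= D].
  exists D, B; split=> //; have := bin_pascal (_ : 0 < n.-1) (_ : 0 < k.-1).
  have -> : n.-1.-1 = n - 2 by lia.
  have -> : k.-1.-1 = k - 2 by lia.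
  by move=> /(_ ltac:(lia) ltac:(lia)); lia.
apply: (cross_pair_bound (V := V)) => //; try lia.
- move=> ? /imsetP[A]; rewrite !inE -andbA => /and3P[_ jA _] ->.
  by apply/subsetP => x; rewrite !inE negb_or => /andP[-> xA]; apply: contraNneq jA => <-.
- by move=> ? /imsetP[A]; rewrite !inE -andbA => /and3P[/layerF <- _ iA] ->; rewrite (cardsD1 i A) iA.
- move=> ? /imsetP[A]; rewrite !inE -andbA => /and3P[_ jA _] ->.
  by apply/subsetP => x; rewrite !inE negb_or andbC => /andP[xA ->]; rewrite andbT; apply: contraNneq jA => <-.
- by move=> ? /imsetP[A]; rewrite !inE -andbA => /and3P[/layerF <- _ iA] ->; rewrite (cardsD1 j A) iA.
(* [A] has [i] but not [j], and [B] the reverse, so their common point survives both deletions. *)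
- move=> ? ? /imsetP[A + ->] /imsetP[B + ->]; rewrite !inE -!andbA.
  move=> /and3P[AF jA iA] /and3P[BF iB jB].
  have /set0Pn[z] := elimT (intersectingP _) Fi _ _ AF BF; rewrite inE => /andP[zA zB].
  apply/set0Pn; exists z; rewrite !inE zA zB !andbT.
  by apply/andP; split; [apply: contraNneq iB => <-|apply: contraNneq jA => <-].
Qed.

(* Among the families of the same size with all codegrees large, take one maximising the sum
   of the codegrees weighted by the index: a shift to a smaller index that changes it must
   make a codegree drop below the threshold. *)
Lemma large_codegree_bound n k u (F : {set {set 'I_n}}) :
  1 < u -> u < k -> 2 * k < n ->
  F \subset layer n k -> intersecting F ->
  (forall e, 'C(n - u.+1, n - k.+1) <= codegree F e) ->
  (n - k.+1) * #|F| + (n - 2 * k) * 'C(n - u.+2, k.-1)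
    <= (n - k.+1) * ('C(n.-1, k.-1) + 'C(n - u.+2, n - k.+1)).
Proof.
move=> u1 uk kn Fk Fi Fg.
suff [D [B [h1 h2 h3]]] : exists D B, [/\ #|F| + D <= 'C(n.-1, k.-1) + 'C(n - u.+2, n - k.+1) + B,
    (n - k.+1) * B <= k.-1 * D & 'C(n - u.+2, k.-1) <= D].
  (* After multiplication by n-k-1, the term in [B] costs at most (k-1) D, which leaves a net gain
     of (n-2k) D. *)
  have e : n - k.+1 = n - 2 * k + k.-1 by lia.
  have := leq_mul (leqnn (n - k.+1)) h1; have := leq_mul (leqnn (n - 2 * k)) h3.
  rewrite !mulnDr => a1 a2.
  have a3 : (n - k.+1) * D = (n - 2 * k) * D + k.-1 * D by rewrite -mulnDl -e.
  lia.
pose P (F' : {set {set 'I_n}}) := [&& F' \subset layer n k, intersecting F', #|F'| == #|F| &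
  [forall e, 'C(n - u.+1, n - k.+1) <= codegree F' e]].
pose pot (F' : {set {set 'I_n}}) := \sum_(e : 'I_n) e * codegree F' e.
have PF : P F by rewrite /P Fk Fi eqxx; apply/forallP.
case: (@arg_maxnP _ F P pot PF) => M /and4P[Mk Mi /eqP cM /forallP Mg] Mmax; rewrite -cM.
case: (boolP [exists i : 'I_n, exists j : 'I_n, (i < j) &&
   (codegree (shift i j M) i < 'C(n - u.+1, n - k.+1))]) => [/existsP[i /existsP[j /andP[ij drop]]]|].
  by apply: drop_bound drop => //; rewrite neq_ltn ij.
move=> /existsPn nodrop.
have stable (i j : 'I_n) B : i < j -> B \in M -> j \in B -> i \notin B -> swap i j B \in M.
  move=> ij BM jB iB.
  have ji : j != i by rewrite neq_ltn ij orbT.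
  have avle : codegree M j <= codegree (shift i j M) j by apply/subset_leq_card/avoid_shift.
  have PM : P (shift i j M).
    rewrite /P shift_layer ?shift_intersecting // card_shift cM eqxx; apply/forallP => e.
    have [->|ei] := eqVneq e i.
      by move/existsPn: (nodrop i) => /(_ j); rewrite ij -leqNgt.
    have [->|ej] := eqVneq e j; first exact: leq_trans avle.
    by rewrite codegree_shift.
  have : pot (shift i j M) <= pot M := Mmax _ PM.
  rewrite /pot (bigD1 i) //= (bigD1 j) //=.
  rewrite [X in _ <= X](bigD1 i) //= [X in _ <= _ + X](bigD1 j) //=.
  rewrite (eq_bigr (fun e : 'I_n => e * codegree M e)); last first.
    by move=> e /andP[ei ej]; rewrite codegree_shift.
  rewrite !addnA leq_add2r => le.
  have := codegree_shift2 i j M => c2.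
  (* The shift moves codegree from [i] to the larger index [j]; any actual move would increase
     [pot]. *)
  have cje : codegree (shift i j M) j = codegree M j.
    move: le c2 avle ij; nia.
  have eqs : [set A in M | j \notin A] = [set A in shift i j M | j \notin A].
    by apply/eqP; rewrite eqEcard avoid_shift -/(codegree (shift i j M) j) cje leqnn.
  have : swap i j B \in [set A in shift i j M | j \notin A].
    by rewrite !inE swapK tpermL tpermR jB (negbTE iB) /= BM orbT.
  by rewrite -eqs inE => /andP[].
have n0 : 0 < n by lia.
pose z := Ordinal n0.
pose G := [set A in M | z \notin A].
have GV A : A \in G -> A \subset [set~ z].
  by rewrite inE => /andP[_ iA]; rewrite subsetC sub1set inE.
have Gk A : A \in G -> #|A| = k.
  by rewrite inE => /andP[/(subsetP Mk) + _]; rewrite inE => /eqP.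
have eV : #|[set~ z]| - k = n - k.+1 by rewrite card_setC1; lia.
have zV : [set~ z] = [set a : 'I_n | 0 < a].
  by apply/setP => a; rewrite !inE -(inj_eq val_inj) /= lt0n.
exists #|avoiders [set~ z] k.-1 G|, #|G|; split.
- apply: leq_trans (star_split _ _ Mk Mi) _; first lia.
  by rewrite leq_add2r leq_addr.
- rewrite zV; apply: avoiders_hit => //; try lia.
    by move=> A a /GV AV aA; have := subsetP AV _ aA; rewrite zV inE.
  by move=> A; rewrite inE => /andP[AM _]; apply: stable_hit AM.
- apply: (avoiders_large (k := k)) => //; rewrite ?eV ?card_setC1; try lia.
  by apply: leq_trans (Mg z); apply: leq_bin2l; lia.
Qed.

(** * Counting *)

Lemma diversity_gt0 n (F : {set {set 'I_n}}) :
  0 < n -> (0 < diversity F) = [forall e, 0 < codegree F e].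
Proof.
move=> n0; have deg e : #|[set A in F | e \in A]| + codegree F e = #|F|.
  rewrite -(cardsID [set A : {set 'I_n} | e \in A] F) /codegree.
  by congr (_ + _); apply: eq_card => A; rewrite !inE // andbC.
rewrite subn_gt0 /max_degree; apply/idP/forallP => [lt e|pos].
  rewrite lt0n; apply: contraL lt => /eqP c0; rewrite -leqNgt -(deg e) c0 addn0.
  exact: (@leq_bigmax _ (fun i : 'I_n => #|[set A in F | i \in A]|)).
have F0 : 0 < #|F| by rewrite -(deg (Ordinal n0)); have := pos (Ordinal n0); lia.
rewrite -(prednK F0) ltnS; apply/bigmax_leqP => e _.
by rewrite -ltnS prednK // -(deg e) -[X in X < _]addn0 ltn_add2l; apply: pos.
Qed.

Definition avoiding_layer n k (e : 'I_n) := [set A in layer n k | e \notin A].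

Lemma card_avoiding_layer n k (e : 'I_n) : #|avoiding_layer k e| = 'C(n.-1, k).
Proof.
rewrite -(card_setC1 e) -cards_draws; apply: eq_card => A.
by rewrite !inE subsetC sub1set inE andbC.
Qed.

Definition compatible n k (e : 'I_n) (G : {set {set 'I_n}}) :=
  [set A in layer n k | (e \in A) && [forall B in G, A :&: B != set0]].

(** Deleting [e] identifies the compatible sets with the [k.-1]-subsets of [[set~ e]] that are not
    avoiders. *)
Lemma card_compatible n k (e : 'I_n) (G : {set {set 'I_n}}) :
  0 < k -> G \subset avoiding_layer k e ->
  #|compatible k e G| + #|avoiders [set~ e] k.-1 G| = 'C(n.-1, k.-1).
Proof.
move=> k0 /subsetP GL; set D := avoiders _ _ _.
set U := [set X : {set 'I_n} | X \subset [set~ e] & #|X| == k.-1].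
rewrite -(card_setC1 e) -cards_draws -/U -(cardsID D U) addnC; congr (_ + _).
  by rewrite (setIidPr _) //; apply/subsetP => X /avoidersP[XV cX _]; rewrite inE XV cX /=.
rewrite -(card_in_imset (f := fun A => A :\ e) (D := mem (compatible k e G))); last first.
  move=> A B; rewrite !inE => /and3P[_ eA _] /and3P[_ eB _] AB.
  by rewrite -(setD1K eA) -(setD1K eB) AB.
apply: eq_card => X; rewrite inE; apply/imsetP/andP => [[A]|[XD]].
  rewrite !inE => /and3P[/eqP cA eA /forall_inP AG] ->; split; last first.
    by rewrite -setTD setSD ?subsetT //= -cA (cardsD1 e A) eA.
  rewrite !negb_and orbA; apply/orP; right; apply/exists_inPn => B BG.
  have := AG _ BG; apply: contra; rewrite -setI_eq0 => /eqP/setP dis.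
  apply/eqP/setP => z; have := dis z; rewrite !inE; case: eqP => [->|_] /=.
    by have := GL _ BG; rewrite !inE => /andP[_ /negbTE eB]; rewrite eB !andbF.
  by rewrite andbC.
rewrite inE => /andP[XV /eqP cX].
have eX : e \notin X by apply/negP => /(subsetP XV); rewrite !inE eqxx.
exists (e |: X); last by rewrite setU1K.
rewrite !inE eqxx cardsU1 eX cX /=; apply/andP; split; first by apply/eqP; lia.
apply/forall_inP => B BG; apply: contra XD => /eqP/setP dis.
apply/avoidersP; split=> //; exists B => //; apply/pred0P => z /=.
by have := dis z; rewrite !inE; case: (z \in B); case: (z \in X); rewrite ?orbT ?andbF.
Qed.

Lemma card_compatible1 n k (e : 'I_n) (A : {set 'I_n}) :
  0 < k -> A \in avoiding_layer k e ->
  #|compatible k e [set A]| = 'C(n.-1, k.-1) - 'C(n - k.+1, k.-1).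
Proof.
move=> k0 AL; rewrite -(card_compatible (e := e) (G := [set A]) k0) ?sub1set //.
move: AL; rewrite !inE => /andP[/eqP cA eA].
rewrite avoiders1; last by rewrite subsetC sub1set inE.
by rewrite card_setC1 cA (_ : n.-1 - k = n - k.+1) ?addnK //; lia.
Qed.

Lemma split_compatible n k (F : {set {set 'I_n}}) (e : 'I_n) :
  F \subset layer n k -> intersecting F ->
  [set A in F | e \notin A] \subset avoiding_layer k e /\
  [set A in F | e \in A] \subset compatible k e [set A in F | e \notin A].
Proof.
move=> /subsetP Fk /intersectingP Fi; split; apply/subsetP => A; rewrite inE => /andP[AF eA].
  by rewrite inE Fk.
rewrite inE Fk // eA /=; apply/forall_inP => B; rewrite inE => /andP[BF _].
exact: Fi.
Qed.

Lemma bin_leq_exp2 n m : 'C(n, m) <= 2 ^ n.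
Proof.
rewrite -{1 2}(card_ord n) -cardsT -cards_draws -card_powerset.
by apply/subset_leq_card/subsetP => A; rewrite !inE => /andP[].
Qed.

Lemma bin_leq_exp m g : 'C(m, g) <= m ^ g.
Proof.
elim: m g => [|m IH] [|g] //.
have mono : m ^ g <= m.+1 ^ g by case: (g) => // g'; rewrite leq_exp2r.
rewrite binS expnS mulSn addnC leq_add //; first exact: leq_trans (IH g) mono.
by apply: leq_trans (IH g.+1) _; rewrite expnS leq_mul.
Qed.

(** With g = [#|G|], the avoiders cost a factor 2^(2ng) relative to the right-hand side. Half of the
    exponent pays for the choice of [G]; as g >= 2, the other half pays for the number of values of
    g and for the factor [2 ^ n]. *)
Lemma sum_small_families n k y (e : 'I_n) :
  1 < k -> 2 * k <= n -> n - k.+1 <= y ->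
  2 * n ^ 2 * 'C(y, n - k.+1) <= k.-1 * 'C(y, k.-1) ->
  (\sum_(G : {set {set 'I_n}} | [&& G \subset avoiding_layer k e, 1 < #|G| & #|G| < 'C(y, n - k.+1)])
     2 ^ #|compatible k e G|) * 2 ^ n
  <= 2 ^ ('C(n.-1, k.-1) - 'C(n - k.+1, k.-1)).
Proof.
move=> k1 kn ky ratio.
have arith c D N t g : 2 * n <= n * g -> t + 2 * n * g <= D -> c + D = N ->
  c + (n + n) + n * g <= N - t by nia.
pose P (G : {set {set 'I_n}}) :=
  [&& G \subset avoiding_layer k e, 1 < #|G| & #|G| < 'C(y, n - k.+1)].
pose M := 'C(n.-1, k); pose r := 2 ^ ('C(n.-1, k.-1) - 'C(n - k.+1, k.-1)).
have Mn : M < 2 ^ n.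
  apply: leq_ltn_trans (bin_leq_exp2 _ _) _; rewrite ltn_exp2l //; lia.
have f_le G : P G -> 2 ^ #|compatible k e G| * 2 ^ (n + n) * (2 ^ n) ^ #|G| <= r.
  case/and3P=> GL G1 Gy; rewrite /r -expnM -!expnD leq_exp2l //.
  have := card_compatible (ltnW k1) GL.
  have GV A : A \in G -> A \subset [set~ e].
    by move=> /(subsetP GL); rewrite !inE subsetC sub1set inE => /andP[].
  have Gk A : A \in G -> #|A| = k.
    by move=> /(subsetP GL); rewrite !inE => /andP[/eqP].
  have := avoiders_small_family k1 kn (card_setC1 e) GV Gk ky ratio G1 (ltnW Gy).
  have : 2 * n <= n * #|G| by rewrite mulnC leq_mul.
  exact: arith.
pose level g := \sum_(G | P G && (#|G| == g)) 2 ^ #|compatible k e G|.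
have level_le g : level g * 2 ^ (n + n) <= r.
  rewrite -(leq_pmul2r (_ : 0 < (2 ^ n) ^ g)) ?expn_gt0 ?expn_gt0 //.
  rewrite big_distrl big_distrl /=.
  apply: (@leq_trans (\sum_(G in [set G : {set {set 'I_n}} | G \subset avoiding_layer k e & #|G| == g]) r)).
    rewrite [X in X <= _]big_mkcond [X in _ <= X]big_mkcond /=; apply: leq_sum => G _.
    case: ifP => // /andP[PG /eqP Gg]; rewrite inE.
    by have /and3P[-> _ _] := PG; rewrite Gg eqxx -[in X in X <= _]Gg f_le.
  rewrite sum_nat_const cards_draws card_avoiding_layer mulnC leq_mul2l.
  by apply/orP; right; apply: leq_trans (bin_leq_exp _ _) _; case: (g) => // g'; rewrite leq_exp2r // ltnW.
have split : \sum_(G | P G) 2 ^ #|compatible k e G| = \sum_(g < M.+1) level g.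
  rewrite (partition_big (fun G : {set {set 'I_n}} => inord #|G| : 'I_M.+1) xpredT) //=.
  apply: eq_bigr => g _; apply: eq_bigl => G; case: (boolP (P G)) => //= /and3P[GL _ _].
  by rewrite -(inj_eq val_inj) /= inordK // ltnS /M -(card_avoiding_layer k e) subset_leq_card.
rewrite split -(leq_pmul2r (_ : 0 < 2 ^ n)) ?expn_gt0 // -mulnA -expnD big_distrl /=.
apply: (@leq_trans (\sum_(g < M.+1) r)); first by apply: leq_sum => g _; apply: level_le.
by rewrite sum_nat_const card_ord mulnC leq_mul2l Mn orbT.
Qed.

(** [F] consists of its members [G] avoiding [e] and a set of sets compatible with [G]. Singletons
    [G] give the main term, larger ones the summand 1. *)
Lemma count_small n k y :
  1 < k -> 2 * k <= n -> n - k.+1 <= y ->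
  2 * n ^ 2 * 'C(y, n - k.+1) <= k.-1 * 'C(y, k.-1) ->
  #|[set F : {set {set 'I_n}} | [&& F \subset layer n k, intersecting F &
      [exists e, 0 < codegree F e < 'C(y, n - k.+1)]]]| * 2 ^ n
  <= n * (2 ^ ('C(n.-1, k.-1) - 'C(n - k.+1, k.-1)) * ('C(n.-1, k) * 2 ^ n + 1)).
Proof.
move=> k1 kn ky ratio; set X := [set F | _]; set r := 2 ^ (_ - _).
pose P e (G : {set {set 'I_n}}) := (G \subset avoiding_layer k e) && (0 < #|G| < 'C(y, n - k.+1)).
pose Y (p : 'I_n * {set {set 'I_n}}) := [set p.2 :|: W | W in powerset (compatible k p.1 p.2)].
have cov : #|X| <= \sum_(p : 'I_n * {set {set 'I_n}} | P p.1 p.2) #|Y p|.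
  apply: card_cover_le => F; rewrite inE => /and3P[Fk Fi /existsP[e Fe]].
  have [sG sW] := split_compatible e Fk Fi.
  exists (e, [set A in F | e \notin A]); first by rewrite /P /= sG.
  apply/imsetP; exists [set A in F | e \in A]; first by rewrite inE.
  by apply/setP => A; rewrite !inE -andb_orr orNb andbT.
have {cov} : #|X| <= \sum_e \sum_(G | P e G) 2 ^ #|compatible k e G|.
  rewrite pair_big_dep /=; apply: leq_trans cov _; apply: leq_sum => p _.
  by apply: leq_trans (leq_imset_card _ _) _; rewrite card_powerset.
rewrite -(leq_pmul2r (_ : 0 < 2 ^ n)) ?expn_gt0 // => /leq_trans; apply.
rewrite -[X in _ <= X * _](card_ord n) -sum_nat_const big_distrl /=.
apply: leq_sum => e _; rewrite (bigID (fun G : {set {set 'I_n}} => #|G| == 1)) /= mulnDl mulnDr leq_add //.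
  rewrite mulnA leq_mul2r; apply/orP; right.
  rewrite mulnC -{1}(bin1 'C(n.-1, k)) -(card_avoiding_layer k e) -cards_draws -sum_nat_const.
  rewrite [X in X <= _]big_mkcond [X in _ <= X]big_mkcond /=; apply: leq_sum => G _.
  case: ifP => // /andP[/andP[GL _] G1]; rewrite inE GL G1 /=.
  by case/cards1P: G1 GL => A ->; rewrite sub1set => AL; rewrite card_compatible1 // ltnW.
rewrite muln1; apply: leq_trans (sum_small_families e k1 kn ky ratio).
rewrite leq_mul2r; apply/orP; right; apply: eq_leq; apply: eq_bigl => G.
by rewrite /P -!andbA [1 < _]ltn_neqAle [1 == _]eq_sym; case: (_ \subset _) => //=; rewrite andbC -andbA; case: (0 < _) => //=; rewrite ?andbF // andbC.
Qed.

(** * Overlaps between points and the lower bounds *)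

(** All but at most two members contain both [e] and [j]. The exponent 2n is for the choice of the
    two exceptional sets, and 2 for their presence. *)
Lemma count_double n k (e j : 'I_n) :
  1 < k -> e != j ->
  #|[set F : {set {set 'I_n}} | [&& F \subset layer n k, codegree F e <= 1 & codegree F j <= 1]]|
  <= 2 ^ (2 * n + 2 + 'C(n - 2, k - 2)).
Proof.
move=> k1 ej; pose S := [set A in layer n k | [set e; j] \subset A].
have c2 : #|[set e; j]| = 2 by rewrite cards2 ej.
have cS : #|S| = 'C(n - 2, k - 2) by rewrite -c2 -card_supersets ?c2.
pose Y (p : {set 'I_n} * {set 'I_n}) := powerset (S :|: [set p.1; p.2]).
(* When the codegree vanishes, the empty set serves as a dummy exception. *)
have one (F : {set {set 'I_n}}) i : codegree F i <= 1 -> exists A, [set A in F | i \notin A] \subset [set A].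
  rewrite leq_eqVlt ltnS leqn0 => /orP[/cards1P[A eA]|]; first by exists A; rewrite -eA.
  by rewrite cards_eq0 => /eqP ->; exists set0; apply: sub0set.
apply: (@leq_trans (\sum_(p : {set 'I_n} * {set 'I_n}) #|Y p|)).
  apply: card_cover_le => F; rewrite inE => /and3P[/subsetP Fk /one[A /subsetP eA] /one[B /subsetP jB]].
  exists (A, B) => //; rewrite inE; apply/subsetP => C CF; rewrite !inE /=.
  case: (boolP (e \in C)) => eC; last first.
    by have := eA C; rewrite !inE CF eC => /(_ isT) ->; rewrite orbT.
  case: (boolP (j \in C)) => jC; last first.
    by have := jB C; rewrite !inE CF jC => /(_ isT) ->; rewrite !orbT.
  by have := Fk _ CF; rewrite inE => ->; rewrite subUset !sub1set eC jC.
apply: (@leq_trans (\sum_(p : {set 'I_n} * {set 'I_n}) 2 ^ ('C(n - 2, k - 2) + 2))).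
  apply: leq_sum => p _; rewrite card_powerset leq_exp2l // cardsU -cS.
  by apply: leq_trans (leq_subr _ _) _; rewrite leq_add2l cards2; case: (_ == _).
rewrite sum_nat_const card_prod -cardsT -powersetT card_powerset cardsT card_ord.
by rewrite -!expnD leq_exp2l //; lia.
Qed.

(** A point of [E e] in no [Bad e j] is good and lies in no other [E j], so it is counted once. If a
    point has no such [e], each of its occurrences in an [E e] is charged to some [Bad e j]. *)
Lemma sum_card_le_overlap (I T : finType) (E : I -> {set T}) (Bad : I -> I -> {set T})
    (Good : {set T}) (b : nat) :
  (forall e x, x \in E e -> (forall j, j != e -> x \notin Bad e j) -> x \in Good) ->
  (forall e j, e != j -> E e :&: E j \subset Bad e j) ->
  (forall e j, e != j -> #|Bad e j| <= b) ->
  \sum_e #|E e| <= #|Good| + #|I| ^ 2 * b.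
Proof.
move=> good EB Bb.
have pointwise x : \sum_e (x \in E e) <=
    (x \in Good) + \sum_e \sum_(j | j != e) (x \in Bad e j).
  case: (boolP [exists e, (x \in E e) && [forall j, (j != e) ==> (x \notin Bad e j)]]).
    case/existsP=> e0 /andP[xE /forallP nb].
    have nB j : j != e0 -> x \notin Bad e0 j by apply/implyP.
    rewrite (good _ _ xE nB) (bigD1 e0) //= xE big1 ?addn0 ?leq_addr // => e ne.
    case: (boolP (x \in E e)) => // xEe.
    have := subsetP (EB e0 e _) x; rewrite eq_sym inE xE xEe => /(_ ne isT).
    by rewrite (negbTE (nB _ ne)).
  move=> /existsPn noE; apply: leq_trans (leq_addl _ _); apply: leq_sum => e _.
  case: (boolP (x \in E e)) => // xE; have := noE e; rewrite xE /= => /forallPn[j].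
  by rewrite negb_imply negbK => /andP[ne xB]; rewrite (bigD1 j) //= xB.
have cardE (A : {set T}) : #|A| = \sum_x (x \in A).
  by rewrite -sum1_card big_mkcond; apply: eq_bigr => x _; case: (x \in A).
under eq_bigr => e _ do rewrite cardE.
rewrite exchange_big /=; apply: leq_trans (leq_sum (index_enum T) (P := xpredT) (fun x _ => pointwise x)) _.
rewrite big_split /= -cardE leq_add2l exchange_big /=.
apply: (@leq_trans (\sum_(e : I) \sum_(j : I) b)); last first.
  by rewrite !sum_nat_const mulnA.
apply: leq_sum => e _; rewrite exchange_big big_mkcond /=; apply: leq_sum => j _.
by case: ifP => // ne; rewrite -cardE Bb // eq_sym.
Qed.

Definition trivial_families n k : {set {set {set 'I_n}}} :=
  [set F : {set {set 'I_n}} |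
    [&& F \subset layer n k, intersecting F & [exists e, codegree F e == 0]]].

Lemma num_intersecting_split n k : 0 < n ->
  num_intersecting n k = #|trivial_families n k| + num_intersecting_div_ge n k 1.
Proof.
move=> n0; rewrite /num_intersecting.
rewrite -(cardsID [set F : {set {set 'I_n}} | [exists e, codegree F e == 0]]); congr (_ + _).
  by apply: eq_card => F; rewrite !inE andbA.
apply: eq_card => F; rewrite !inE diversity_gt0 // andbC andbA; congr (_ && _).
by rewrite negb_exists; apply: eq_forallb => e; rewrite lt0n.
Qed.

Lemma codegree0 n (F : {set {set 'I_n}}) e A : codegree F e = 0 -> A \in F -> e \in A.
Proof.
move=> /eqP; rewrite cards_eq0 => /eqP/setP/(_ A); rewrite !inE => + AF.
by rewrite AF /= => /negbFE.
Qed.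

Definition star_families n k (e : 'I_n) := powerset [set A in layer n k | [set e] \subset A].

Lemma card_star_families n k (e : 'I_n) : 0 < k -> #|star_families k e| = 2 ^ 'C(n.-1, k.-1).
Proof. by move=> k0; rewrite card_powerset card_supersets cards1 ?subn1. Qed.

Lemma in_star_families n k (e : 'I_n) (F : {set {set 'I_n}}) :
  (F \in star_families k e) = (F \subset layer n k) && (codegree F e == 0).
Proof.
rewrite inE; apply/subsetP/andP => [FS|[/subsetP Fk /eqP F0] A AF].
  split; first by apply/subsetP => A /FS; rewrite inE => /andP[].
  rewrite cards_eq0; apply/eqP/setP => A; rewrite !inE; apply/negP => /andP[/FS].
  by rewrite inE sub1set => /andP[_ ->].
by rewrite inE Fk //= sub1set (codegree0 F0).
Qed.

Lemma card_trivial_le n k : 0 < k -> #|trivial_families n k| <= n * 2 ^ 'C(n.-1, k.-1).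
Proof.
move=> k0; apply: (@leq_trans (\sum_(e : 'I_n) #|star_families k e|)).
  apply: card_cover_le => F; rewrite inE => /and3P[Fk _ /existsP[e F0]].
  by exists e; rewrite // in_star_families Fk.
rewrite (eq_bigr (fun=> 2 ^ 'C(n.-1, k.-1))); last by move=> e _; apply: card_star_families.
by rewrite sum_nat_const card_ord.
Qed.

(** The bound 1 lets the same families control both the stars (codegree 0) and the families of
    codegree 1. *)
Definition twofold n k (e j : 'I_n) : {set {set {set 'I_n}}} :=
  [set F : {set {set 'I_n}} | [&& F \subset layer n k, codegree F e <= 1 & codegree F j <= 1]].

Lemma card_trivial_ge n k : 1 < k ->
  n * 2 ^ 'C(n.-1, k.-1)
  <= #|trivial_families n k| + n ^ 2 * 2 ^ (2 * n + 2 + 'C(n - 2, k - 2)).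
Proof.
move=> k1; have k0 : 0 < k by lia.
have -> : n * 2 ^ 'C(n.-1, k.-1) = \sum_(e : 'I_n) #|star_families k e|.
  rewrite (eq_bigr (fun=> 2 ^ 'C(n.-1, k.-1))); last by move=> e _; apply: card_star_families.
  by rewrite sum_nat_const card_ord.
have -> : n ^ 2 = #|'I_n| ^ 2 by rewrite card_ord.
apply: (sum_card_le_overlap (Bad := @twofold n k)) => [e F|e j _|e j ne].
- rewrite in_star_families => /andP[Fk F0] _; rewrite inE Fk /=; apply/andP; split; last first.
    by apply/existsP; exists e.
  apply/intersectingP => A B AF BF; apply/set0Pn; exists e.
  by rewrite inE !(codegree0 (eqP F0)).
- apply/subsetP => F; rewrite inE !in_star_families => /andP[/andP[Fk /eqP Fe] /andP[_ /eqP Fj]].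
  by rewrite inE Fk Fe Fj.
- exact: count_double.
Qed.

(** Any set [A] avoiding [e], together with any sets compatible with it, forms such a family, and
    [A] is recovered as its only member without [e]. *)
Lemma card_codegree1 n k (e : 'I_n) : 0 < k ->
  'C(n.-1, k) * 2 ^ ('C(n.-1, k.-1) - 'C(n - k.+1, k.-1)) <=
  #|[set F : {set {set 'I_n}} | [&& F \subset layer n k, intersecting F & codegree F e == 1]]|.
Proof.
move=> k0; pose L := avoiding_layer k e.
pose Q := [set p : {set 'I_n} * {set {set 'I_n}} |
  (p.1 \in L) && (p.2 \subset compatible k e [set p.1])].
have cQ : #|Q| = 'C(n.-1, k) * 2 ^ ('C(n.-1, k.-1) - 'C(n - k.+1, k.-1)).
  rewrite -(card_avoiding_layer k e) -sum_nat_const -sum1_card.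
  rewrite (eq_bigl (fun p : {set 'I_n} * {set {set 'I_n}} => (p.1 \in L) && (p.2 \subset compatible k e [set p.1]))); last by move=> p; rewrite inE.
  rewrite -(pair_big_dep (mem L) (fun (A : {set 'I_n}) (W : {set {set 'I_n}}) => W \subset compatible k e [set A]) (fun _ _ => 1)) /=.
  apply: eq_bigr => A AL; rewrite sum1_card -(card_compatible1 k0 AL) -card_powerset.
  by apply: eq_card => W; rewrite !inE.
have avoidL (A : {set 'I_n}) : A \in L -> [/\ #|A| = k & e \notin A] by rewrite !inE => /andP[/eqP].
have compe (A B : {set 'I_n}) (W : {set {set 'I_n}}) : W \subset compatible k e [set A] -> B \in W ->
    [/\ #|B| = k, e \in B & B :&: A != set0].
  move=> /subsetP WS /WS; rewrite !inE => /and3P[/eqP cB eB /forall_inP h].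
  by split=> //; apply: h; rewrite inE.
rewrite -cQ -(card_in_imset (f := fun p : {set 'I_n} * {set {set 'I_n}} => p.1 |: p.2)); last first.
  move=> [A W] [A' W']; rewrite inE [(A', W') \in Q]inE /= => /andP[AL WS] /andP[AL' WS'] eq.
  have [_ eA] := avoidL _ AL; have [_ eA'] := avoidL _ AL'.
  have AA' : A = A'.
    have : A \in A' |: W' by rewrite -eq setU11.
    by case/setU1P => // /(compe _ _ _ WS')[_]; rewrite (negbTE eA).
  rewrite AA' in eq WS eA *; congr (_, _).
  have nW (V : {set {set 'I_n}}) : V \subset compatible k e [set A'] -> A' \notin V.
    by move=> VS; apply/negP => /(compe _ _ _ VS)[_]; rewrite (negbTE eA').
  by rewrite -(setU1K (nW _ WS)) -(setU1K (nW _ WS')) eq.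
apply/subset_leq_card/subsetP => F /imsetP[[A W]]; rewrite inE /= => /andP[AL WS] ->.
have [cA eA] := avoidL _ AL.
rewrite inE; apply/and3P; split.
- rewrite subUset sub1set in_layer cA eqxx /=; apply/subsetP => B /(compe _ _ _ WS)[cB _ _].
  by rewrite in_layer cB.
- apply/intersectingP => B C /setU1P[->|/(compe _ _ _ WS)[_ eB BA]] /setU1P[->|/(compe _ _ _ WS)[_ eC CA]] //.
  + by rewrite setIid -card_gt0 cA.
  + by rewrite setIC.
  + by apply/set0Pn; exists e; rewrite inE eB.
- apply/cards1P; exists A; apply/setP => B; rewrite !inE.
  case: eqP => [->|_] /=; first by rewrite eA.
  by apply/negP => /andP[/(compe _ _ _ WS)[_ ->]].
Qed.

(** A family of codegree 1 at [e] can be trivial only through a vanishing codegree at another point,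
    which makes it [twofold]. *)
Lemma nontrivial_ge n k : 1 < k -> 0 < n ->
  n * ('C(n.-1, k) * 2 ^ ('C(n.-1, k.-1) - 'C(n - k.+1, k.-1)))
  <= num_intersecting_div_ge n k 1 + n ^ 2 * 2 ^ (2 * n + 2 + 'C(n - 2, k - 2)).
Proof.
move=> k1 n0; have k0 : 0 < k by lia.
pose E (e : 'I_n) := [set F : {set {set 'I_n}} |
  [&& F \subset layer n k, intersecting F & codegree F e == 1]].
apply: (@leq_trans (\sum_e #|E e|)).
  rewrite -[X in X * _](card_ord n) -sum_nat_const; apply: leq_sum => e _.
  exact: card_codegree1.
have -> : n ^ 2 = #|'I_n| ^ 2 by rewrite card_ord.
apply: (sum_card_le_overlap (Bad := @twofold n k)) => [e F|e j _|e j ne].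
- rewrite inE => /and3P[Fk Fi /eqP Fe] nb; rewrite inE Fk Fi diversity_gt0 //=.
  apply/forallP => j; case: (eqVneq j e) => [->|/nb]; first by rewrite Fe.
  by rewrite inE Fk Fe /= -ltnNge => /ltnW.
- apply/subsetP => F; rewrite !inE => /andP[/and3P[Fk _ /eqP Fe] /and3P[_ _ /eqP Fj]].
  by rewrite Fk Fe Fj.
- exact: count_double.
Qed.

(** Either some codegree is below the threshold and [count_small] applies, or none is and
    [count_bounded] does; the last hypothesis turns [large_codegree_bound] into a saving of [m] in
    the size. *)
Lemma nontrivial_le n k u m :
  1 < u -> u < k -> 2 * k < n ->
  2 * n ^ 2 * 'C(n - u.+1, n - k.+1) <= k.-1 * 'C(n - u.+1, k.-1) ->
  (n - k.+1) * ('C(n - u.+2, n - k.+1) + m) <= (n - 2 * k) * 'C(n - u.+2, k.-1) ->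
  num_intersecting_div_ge n k 1 * 2 ^ n
  <= n * (2 ^ ('C(n.-1, k.-1) - 'C(n - k.+1, k.-1)) * ('C(n.-1, k) * 2 ^ n + 1))
     + 2 ^ (n * 'C(2 * k, k) + ('C(n.-1, k.-1) - m)) * 2 ^ n.
Proof.
move=> u1 uk kn ratio big.
have small := count_small (ltnW (leq_ltn_trans u1 uk) : 1 < k) (ltnW kn) (_ : n - k.+1 <= n - u.+1) ratio.
have bound (F : {set {set 'I_n}}) : F \subset layer n k -> intersecting F ->
  (forall e, 'C(n - u.+1, n - k.+1) <= codegree F e) -> #|F| <= 'C(n.-1, k.-1) - m.
  move=> Fk Fi Fg; have h := large_codegree_bound u1 uk kn Fk Fi Fg.
  have p : 0 < n - k.+1 by lia.
  suff : #|F| + m <= 'C(n.-1, k.-1) by lia.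
  rewrite -(leq_pmul2l p); move: h big; rewrite !mulnDr; lia.
have large := count_bounded (ltnW (ltnW (leq_ltn_trans u1 uk)) : 0 < k) bound.
apply: (@leq_trans ((#|[set F : {set {set 'I_n}} | [&& F \subset layer n k, intersecting F &
      [exists e, 0 < codegree F e < 'C(n - u.+1, n - k.+1)]]]| +
   #|[set F : {set {set 'I_n}} | [&& F \subset layer n k, intersecting F &
      [forall e, 'C(n - u.+1, n - k.+1) <= codegree F e]]]|) * 2 ^ n)).
  rewrite leq_mul2r; apply/orP; right.
  apply: leq_trans _ (leq_card_setU _ _); apply/subset_leq_card/subsetP => F.
  rewrite !inE diversity_gt0; last by lia.
  move=> /and3P[-> -> /forallP pos] /=; rewrite orbC; apply/orP.
  case: (boolP [forall e, _]) => [_|/forallPn[e]]; [by left|right].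
  by apply/existsP; exists e; rewrite pos ltnNge.
rewrite mulnDl leq_add //; first by apply: small; lia.
by rewrite leq_mul2r large orbT.
Qed.

(** * Binomial estimates *)

(** The hypothesis says that each quotient C(y,i+1) / C(y,i) = (y-i)/(i+1) in the range is at least
    A/B; the product telescopes. *)
Lemma bin_ratio_pow (A B y b s : nat) :
  (forall i, b <= i < b + s -> A * i.+1 <= B * (y - i)) ->
  A ^ s * 'C(y, b) <= B ^ s * 'C(y, b + s).
Proof.
elim: s => [|s IH] h; first by rewrite addn0 leqnn.
have {}IH := IH (fun i hi => h i (ltac:(lia))).
have step : A * 'C(y, b + s) <= B * 'C(y, b + s.+1).
  rewrite -(leq_pmul2l (ltn0Sn (b + s))) addnS [X in _ <= X]mulnCA mul_bin_left.
  by rewrite !mulnA leq_mul2r mulnC h ?orbT //; lia.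
rewrite !expnS -mulnA; apply: leq_trans (leq_mul (leqnn A) IH) _.
by rewrite mulnCA [B * _]mulnC -mulnA leq_mul2l step orbT.
Qed.

Lemma bin_homo_half (y b b' : nat) : b <= b' -> 2 * b' <= y.+1 -> 'C(y, b) <= 'C(y, b').
Proof.
move=> bb' b'y; have := @bin_ratio_pow 1 1 y b (b' - b).
by rewrite !exp1n !mul1n subnKC //; apply => i; lia.
Qed.

(** C(x+1,j) / C(x,j) = (x+1)/(x+1-j) is at least 6/5 as long as x+1 <= 6j. *)
Lemma bin_growth (x j s : nat) : 0 < j -> x + s <= 6 * j -> j <= x ->
  6 ^ s * 'C(x, j) <= 5 ^ s * 'C(x + s, j).
Proof.
move=> j0; elim: s => [|s IH] h jx; first by rewrite addn0 leqnn.
have {}IH := IH ltac:(lia) jx.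
have step : 6 * 'C(x + s, j) <= 5 * 'C(x + s.+1, j).
  rewrite -(leq_pmul2l (_ : 0 < x + s.+1 - j)); last lia.
  rewrite [X in _ <= X]mulnCA -mul_bin_down addnS /= !mulnA leq_mul2r; apply/orP; right; lia.
rewrite !expnS -mulnA; apply: leq_trans (leq_mul (leqnn 6) IH) _.
by rewrite mulnCA [5 * _]mulnC -mulnA leq_mul2l step orbT.
Qed.

Lemma bin_pascal_iter (x j s : nat) : 'C(x, j.+1) + s * 'C(x, j) <= 'C(x + s, j.+1).
Proof.
elim: s => [|s IH]; first by rewrite addn0 addn0.
rewrite addnS binS mulSn [_ + s * _]addnC addnA leq_add //.
exact/leq_bin2l/leq_addr.
Qed.

(** Each quotient is at least (n-k-s)/(k-s), hence at least (n-k)/k because n-k >= k. *)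
Lemma bin_shifted_ratio (n k s c : nat) :
  c + 2 * s <= k -> 2 * k <= n ->
  (n - k) ^ s * 'C(n - k.+1 + c, c) <= k ^ s * 'C(n - k.+1 + c, c + s).
Proof.
move=> csk kn; apply: bin_ratio_pow => i /andP[ci ics].
have h1 : i.+1 <= k - s by lia.
have h2 : n - k - s <= n - k.+1 + c - i by lia.
apply: leq_trans (leq_mul (leqnn _) h1) _; apply: leq_trans _ (leq_mul (leqnn _) h2).
have : k <= n - k by lia.
move: (n - k) => m km; rewrite !mulnBr [k * m]mulnC; apply: leq_sub2l.
by rewrite leq_mul2r km orbT.
Qed.

(** The indices [c + s] and [k.-1] lie in the increasing half of the row, so the quotient is at
    least ((n-k)/k)^s. Two of these factors absorb [n ^ 2], since n <= 2(n-k); the others supply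
    16k. *)
Lemma numeric_ratio (n k s c : nat) :
  1 < k -> c + 2 * s <= k -> 2 * k < n -> c + s <= k.-1 -> 2 * k.-1 <= n - k + c -> 1 < s ->
  16 * k * k ^ (s - 2) <= (n - k) ^ (s - 2) ->
  2 * n ^ 2 * 'C(n - k.+1 + c, c) <= k.-1 * 'C(n - k.+1 + c, k.-1).
Proof.
move=> k1 csk kn csk1 half s1 big.
have p : 0 < (n - k) ^ s by rewrite expn_gt0; apply/orP; left; lia.
have := bin_shifted_ratio csk (ltnW kn).
have := @bin_homo_half (n - k.+1 + c) (c + s) k.-1 csk1 ltac:(lia).
set X := 'C(_, c); set Y := 'C(_, c + s); set Z := 'C(_, k.-1) => YZ XY.
have pw : 2 * n ^ 2 * k ^ s <= k.-1 * (n - k) ^ s.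
  rewrite -(subnK s1) !expnD; move: big; set a := k ^ _; set b := (n - k) ^ _ => big.
  have e1 : n ^ 2 <= 4 * (n - k) ^ 2.
    by rewrite -(expnMn 2 _ 2) leq_exp2r //; lia.
  have e2 : 8 * k ^ 2 * a <= k.-1 * b.
    apply: leq_trans _ (leq_mul (leqnn k.-1) big).
    rewrite !mulnA leq_mul2r; apply/orP; right; nia.
  apply: (@leq_trans (8 * k ^ 2 * a * (n - k) ^ 2)); last first.
    by rewrite mulnA leq_mul2r e2 orbT.
  apply: (@leq_trans (2 * (4 * (n - k) ^ 2) * (a * k ^ 2))).
    by rewrite leq_mul // leq_mul.
  by apply: eq_leq; lia.
rewrite -(leq_pmul2l p) mulnCA.
apply: leq_trans (leq_mul (leqnn _) XY) _.
rewrite mulnA [X in _ <= X]mulnA; apply: leq_mul => //.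
by rewrite [X in _ <= X]mulnC.
Qed.

Lemma bin_growth_factor (M x y j s : nat) :
  0 < j -> x + s <= 6 * j -> j <= x -> x + s <= y -> M * 5 ^ s <= 6 ^ s ->
  M * 'C(x, j) <= 'C(y, j).
Proof.
move=> j0 xs jx sy big; apply: leq_trans _ (leq_bin2l j sy).
rewrite -(leq_pmul2l (_ : 0 < 5 ^ s)) ?expn_gt0 // mulnA [5 ^ s * M]mulnC.
by apply: leq_trans (leq_mul big (leqnn _)) (bin_growth j0 xs jx).
Qed.

Lemma central_bin_pred k : 0 < k -> 'C(2 * k, k) <= 2 * 'C(2 * k, k.-1).
Proof.
case: k => // k _; have := mul_bin_left (2 * k.+1) k.
have -> : 2 * k.+1 - k = k.+2 by lia.
by move=> /= e; rewrite -(leq_pmul2l (ltn0Sn k)) e mulnA leq_mul2r; apply/orP; right; lia.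
Qed.

Lemma central_bin_pred3 k : 7 <= k -> 'C(2 * k, k) <= 8 * 'C(2 * k, k - 3).
Proof.
move=> k5; apply: leq_trans (central_bin_pred _) _; first lia.
have step j : k - 3 <= j -> j.+1 <= k -> 'C(2 * k, j.+1) <= 2 * 'C(2 * k, j).
  move=> kj jk; have e := mul_bin_left (2 * k) j.
  rewrite -(leq_pmul2l (ltn0Sn j)) e mulnA leq_mul2r; apply/orP; right; lia.
have := step (k - 3) ltac:(lia) ltac:(lia); have := step (k - 2) ltac:(lia) ltac:(lia).
rewrite (_ : (k - 2).+1 = k.-1); last by lia.
rewrite (_ : (k - 3).+1 = k - 2); last by lia.
lia.
Qed.

(** Up to [n = 4 * k], 2q growth steps by 6/5 beat all polynomial factors. Beyond that [bin_growth]
    may not apply to the first coefficient; iterating Pascal's rule then shows that the right-hand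
    coefficient exceeds it by a multiple of C(n-k-1,k-2), which dominates the remaining terms. *)
Lemma numeric_saving (n k q : nat) :
  100 <= k -> 12 * q <= k -> 2 * k + 2 + 8 * q <= n ->
  96 * k ^ 2 * 5 ^ (2 * q) <= 6 ^ (2 * q) ->
  (n - k.+1) * ('C(n - k.+1, k.-1) + 2 * n * 'C(2 * k, k))
  <= (n - 2 * k).-1 * 'C(n - (6 * q).+2, k.-1).
Proof.
move=> k100 qk kn big.
case: (leqP n (4 * k)) => n4k.
  have h1 : 96 * k ^ 2 * 'C(n - k.+1, k.-1) <= 'C(n - (6 * q).+2, k.-1).
    by apply: bin_growth_factor big; lia.
  (* The hypothesis [2 * k + 2 + 8 * q <= n] gives exactly the room for 2q steps up from [2 * k]. *)
  have h2 : 96 * k ^ 2 * 'C(2 * k, k.-1) <= 'C(n - (6 * q).+2, k.-1).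
    by apply: bin_growth_factor big; lia.
  have h3 := @central_bin_pred k ltac:(lia).
  move: h1 h2 h3; set t := 'C(_, _); set Z := 'C(n - _, _); set C' := 'C(_, k.-1); set C := 'C(_, k).
  move=> h1 h2 h3.
  have p : 0 < (n - 2 * k).-1 by lia.
  apply: (@leq_trans Z); last by rewrite leq_pmull.
  have h4 : 48 * k ^ 2 * C <= Z.
    apply: leq_trans h2; rewrite (_ : 96 * k ^ 2 * C' = 48 * k ^ 2 * (2 * C')); last by lia.
    by rewrite leq_mul2l h3 orbT.
  have h5 : (n - k.+1) * t <= 3 * k * t by rewrite leq_mul2r; apply/orP; right; lia.
  have h6 : (n - k.+1) * (2 * n * C) <= 3 * k * (2 * (4 * k) * C).
    by apply: leq_mul; [lia | rewrite leq_mul2r leq_mul2l n4k !orbT].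
  have h7 : 3 * k * (2 * (4 * k) * C) = 24 * k ^ 2 * C by lia.
  have h8 : 3 * k * t <= 48 * k ^ 2 * t by rewrite leq_mul2r; apply/orP; right; nia.
  rewrite mulnDr; lia.
have h1 : 'C(n - k.+1, k.-1) + (k.-1 - 6 * q) * 'C(n - k.+1, k - 2) <= 'C(n - (6 * q).+2, k.-1).
  have := bin_pascal_iter (n - k.+1) (k - 2) (k.-1 - 6 * q).
  rewrite (_ : (k - 2).+1 = k.-1); last by lia.
  by rewrite (_ : n - k.+1 + (k.-1 - 6 * q) = n - (6 * q).+2); last by lia.
have h2 : k.-1 * 'C(n - k.+1, k.-1) = (n - 2 * k).+1 * 'C(n - k.+1, k - 2).
  have := mul_bin_left (n - k.+1) (k - 2).
  rewrite (_ : (k - 2).+1 = k.-1); last by lia.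
  by rewrite (_ : n - k.+1 - (k - 2) = (n - 2 * k).+1); last by lia.
have h3 : 36 * n * 'C(2 * k, k) <= k * 'C(n - k.+1, k - 2).
  have b : 96 * k ^ 2 * 'C(2 * k, k - 3) <= 'C(n - k.+2, k - 3).
    by apply: bin_growth_factor big; lia.
  have d : (n - k.+1) * 'C(n - k.+2, k - 3) = (k - 2) * 'C(n - k.+1, k - 2).
    have := mul_bin_diag (n - k.+1) (k - 3).
    rewrite (_ : (k - 3).+1 = k - 2); last by lia.
    by rewrite (_ : (n - k.+1).-1 = n - k.+2); last by lia.
  have c3 := @central_bin_pred3 k ltac:(lia).
  apply: (@leq_trans ((k - 2) * 'C(n - k.+1, k - 2))); last by rewrite leq_mul2r; apply/orP; right; lia.
  rewrite -d; move: b c3; set b1 := 'C(2 * k, k - 3); set b2 := 'C(n - k.+2, _); set C := 'C(2 * k, k).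
  move=> b c3.
  have k2 : 10000 <= k ^ 2 by rewrite (leq_exp2r 100 k (isT : 0 < 2)).
  have h : 72 * C <= b2.
    apply: leq_trans _ b; apply: (@leq_trans (72 * (8 * b1))); first by rewrite leq_mul2l c3.
    by rewrite mulnA leq_mul2r; apply/orP; right; lia.
  have nn : n <= 2 * (n - k.+1) by lia.
  have := leq_mul nn h; lia.
move: h1 h2 h3; set t := 'C(_, k.-1); set Z := 'C(n - _.+2, _); set C' := 'C(_, k - 2); set C := 'C(_, k).
move=> h1 h2 h3.
have k3 : k <= 3 * (k.-1 - 6 * q) by lia.
move: h1 k3; set w := k.-1 - 6 * q => h1 k3.
set a := (n - 2 * k).-1.
have ea : n - k.+1 = a + k by rewrite /a; lia.
have eb : (n - 2 * k).+1 = a + 2 by rewrite /a; lia.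
have an : n <= 2 * a + 4 by rewrite /a; lia.
have ak : 2 * k <= a + 1 by rewrite /a; lia.
rewrite ea; rewrite eb in h2.
apply: leq_trans _ (leq_mul (leqnn a) h1); rewrite mulnDr [X in _ <= X]mulnDr mulnDl -addnA leq_add2l.
clearbody t Z C' C w a; clear ea eb h1 qk kn big n4k.
have s1 : 3 * (a * (w * C')) >= a * k * C' by have := leq_mul (leq_mul (leqnn a) k3) (leqnn C'); lia.
have s2 : k * t <= 2 * (a + 2) * C' by rewrite -mulnA -h2; nia.
have s3 : 36 * ((a + k) * (2 * n * C)) <= 2 * (a + k) * (k * C').
  by have := leq_mul (leqnn (2 * (a + k))) h3; lia.
have s4 : 2 * (a + k) * (k * C') <= 4 * a * (k * C').
  by rewrite leq_mul2r; apply/orP; right; lia.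
have s5 : 100 * (a * C') <= a * k * C'.
  by rewrite mulnA leq_mul2r; apply/orP; right; rewrite mulnC leq_mul2l k100 orbT.
have s6 : 100 * C' <= a * C' by rewrite leq_mul2r; apply/orP; right; lia.
lia.
Qed.

(** Both [k.-1] and its complementary index n-2k are at least 2, so C(x,2) is a lower bound. *)
Lemma bin_ge_linear n k : 100 <= k -> 2 * k + 2 <= n -> 3 * n <= 'C(n - k.+1, k.-1).
Proof.
move=> k100 kn; set x := n - k.+1.
have xk : k < x /\ n <= 2 * x + 2 by rewrite /x; lia.
have c2 : 3 * n <= 'C(x, 2).
  rewrite bin2 -leq_double; have := odd_double_half (x * x.-1).
  have -> : odd (x * x.-1) = false by rewrite oddM; case: (x) => //= x'; rewrite andNb.
  rewrite add0n => ->; nia.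
apply: leq_trans c2 _.
case: (leqP (2 * k.-1) x.+1) => h; first by apply: bin_homo_half; lia.
by rewrite -[X in _ <= X]bin_sub; [apply: bin_homo_half|]; lia.
Qed.

Lemma central_bin_ge4 k : 2 <= k -> 4 <= 'C(2 * k, k).
Proof.
move=> k2; have : 'C(2 * k, 1) <= 'C(2 * k, k) by apply: bin_homo_half; lia.
by rewrite bin1; lia.
Qed.

Lemma bin_two_points n k : 1 < n -> 1 < k ->
  'C(n.-1, k.-1) = 'C(n - 2, k - 2) + 'C(n - 2, k.-1).
Proof.
case: n => // -[//|n] _; case: k => // -[//|k] _.
by rewrite /= !subSS !subn0 binS addnC.
Qed.

(** * Assembly of the error terms *)

(** The factor [2 ^ n] clears denominators: the two ratios of the theorem are off by at most 2^-n
    and twice 2^-n respectively. *)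
Lemma counting_bounds (n k q : nat) :
  100 <= k -> 2 <= q -> 12 * q <= k -> 2 * k + 2 + 8 * q <= n ->
  96 * k ^ 2 * 5 ^ (2 * q) <= 6 ^ (2 * q) ->
  16 * k * k ^ (3 * q - 2) <= (n - k) ^ (3 * q - 2) ->
  let N := 'C(n.-1, k.-1) in
  let main := n * 'C(n.-1, k) * 2 ^ (N - 'C(n - k.+1, k.-1)) in
  [/\ num_intersecting n k * 2 ^ n <= n * 2 ^ N * 2 ^ n + 2 ^ N,
      n * 2 ^ N * 2 ^ n <= num_intersecting n k * 2 ^ n + 2 ^ N,
      num_intersecting_div_ge n k 1 * 2 ^ n <= main * 2 ^ n + 2 * main &
      main * 2 ^ n <= num_intersecting_div_ge n k 1 * 2 ^ n + main].
Proof.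
move=> k100 q2 qk kn big1 big2 /=.
have saving := numeric_saving k100 qk kn big1.
have n0 : 0 < n by clear -k100 kn; lia.
have n1 : 1 < n by clear -k100 kn; lia.
have k0 : 0 < k by clear -k100; lia.
have k1 : 1 < k by clear -k100; lia.
have nk0 : 0 < n - k.+1 by clear -k100 kn; lia.
have y_eq : n - (6 * q).+1 = n - k.+1 + (k - 6 * q) by clear -k100 qk kn; lia.
have z_eq : n - (6 * q).+2 = n - k.+1 + (k - (6 * q).+1) by clear -k100 qk kn; lia.
have ratio c : c + 6 * q <= k -> k <= c + 6 * q + 1 ->
    2 * n ^ 2 * 'C(n - k.+1 + c, n - k.+1) <= k.-1 * 'C(n - k.+1 + c, k.-1).
  move=> c1 c2.
  have -> : 'C(n - k.+1 + c, n - k.+1) = 'C(n - k.+1 + c, c).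
    by rewrite -[RHS]bin_sub ?addnK // leq_addl.
  by apply: (@numeric_ratio n k (3 * q) c) => //; clear -k100 q2 qk kn c1 c2; lia.
have ratio1 : 2 * n ^ 2 * 'C(n - (6 * q).+1, n - k.+1) <= k.-1 * 'C(n - (6 * q).+1, k.-1).
  by rewrite y_eq; apply: ratio; clear -k100 qk; lia.
have ratio2 : 2 * n ^ 2 * 'C(n - (6 * q).+2, n - k.+1) <= k.-1 * 'C(n - (6 * q).+2, k.-1).
  by rewrite z_eq; apply: ratio; clear -k100 qk; lia.
clear big1 big2 ratio y_eq z_eq.
have lin := bin_ge_linear k100 (leq_trans (leq_addr _ _) kn).
have C4 := @central_bin_ge4 k k1.
have NC := @bin_two_points n k n1 k1.
have ZN : 'C(n - (6 * q).+2, k.-1) <= 'C(n - 2, k.-1).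
  by apply: leq_bin2l; clear; lia.
have M0 : 0 < 'C(n.-1, k) by rewrite bin_gt0; clear -k100 kn; lia.
have Mn := bin_leq_exp2 n.-1 k.
(* The first summand matches the exponent lost in the main term. Half of the second pays for the
   number of maximal families, the other half for the factor [2 ^ n]. *)
set m := 'C(n - k.+1, k.-1) + 2 * n * 'C(2 * k, k) in saving *.
have nontriv := @nontrivial_le n k (6 * q) m ltac:(clear -q2; lia)
  ltac:(clear -k100 qk; lia) ltac:(clear -kn; lia) ratio1.
have mZ : m <= 'C(n - (6 * q).+2, k.-1).
  rewrite -(leq_pmul2l nk0); apply: leq_trans saving _.
  by rewrite leq_mul2r; apply/orP; right; clear -k100 kn; lia.
have {}nontriv : num_intersecting_div_ge n k 1 * 2 ^ n <=
    n * (2 ^ ('C(n.-1, k.-1) - 'C(n - k.+1, k.-1)) * ('C(n.-1, k) * 2 ^ n + 1))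
     + 2 ^ (n * 'C(2 * k, k) + ('C(n.-1, k.-1) - m)) * 2 ^ n.
  apply: nontriv; rewrite mulnDr.
  move: ratio2 saving; set g1 := 'C(n - _.+2, n - _); set Z := 'C(n - _.+2, k.-1) => ratio2 saving.
  have g1Z : (n - k.+1) * g1 <= Z.
    rewrite -(leq_pmul2l n0); apply: (@leq_trans (2 * n ^ 2 * g1)); last first.
      by apply: leq_trans ratio2 _; rewrite leq_mul2r; apply/orP; right; clear -k100 kn; lia.
    rewrite mulnA leq_mul2r; apply/orP; right.
    by rewrite expnS expn1 mulnCA leq_mul2l; apply/orP; right; clear; lia.
  (* The predecessor in [saving] leaves one copy of [Z] to pay for the threshold term [g1]. *)
  apply: leq_trans (leq_add g1Z saving) _.
  by rewrite -mulSn prednK //; clear -k100 kn; lia.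
have split := num_intersecting_split k n0.
have tl := card_trivial_le n k0.
have tg := card_trivial_ge n k1.
have ng := nontrivial_ge k1 n0.
move: split tl tg ng nontriv lin NC mZ ZN; clear saving ratio1 ratio2; rewrite {}/m.
move: #|trivial_families n k| (num_intersecting n k) (num_intersecting_div_ge n k 1) => I0 I I1.
move: 'C(n - _.+2, k.-1) => Z.
move: 'C(n - 2, k - 2) 'C(n - 2, k.-1) => C2 C3.
move: Mn M0 C4; move: 'C(n.-1, k) 'C(n - k.+1, k.-1) 'C(2 * k, k) => M t C Mn M0 C4.
move: 'C(n.-1, k.-1) => N -> tl tg ng nontriv lin NC mZ ZN.
have nC : 4 * n <= n * C by rewrite mulnC leq_mul2l C4 orbT.
have n2 : n < 2 ^ n by apply: ltn_expl.
have n1' : n <= 2 ^ n.-1 by rewrite -(prednK n0); apply: ltn_expl.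
(* Here C2 = N - C3, and C3 >= Z >= t + 2nC >= t + 8n leaves room for the extra 5n + 2. *)
have e5 : 2 ^ (2 * n + 2 + C2) * n ^ 2 * 2 ^ n <= 2 ^ (N - t).
  apply: (@leq_trans (2 ^ (2 * n + 2 + C2) * 2 ^ (2 * n) * 2 ^ n)).
    by rewrite leq_mul2r leq_mul2l mulnC expnM leq_exp2r ?(ltnW n2) ?orbT.
  by rewrite -!expnD leq_exp2l //; lia.
have e6 : 2 ^ (n * C + (N - (t + 2 * n * C))) * 2 ^ n <= 2 ^ (N - t).
  by rewrite -expnD leq_exp2l //; lia.
have e7 : 2 ^ (N - t) <= 2 ^ N by rewrite leq_exp2l // leq_subr.
set P := 2 ^ (N - t) in e5 e6 e7 tg ng nontriv *.
have e8 : I1 * 2 ^ n <= P * (n * M * 2 ^ n + n + 1).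
  apply: leq_trans nontriv _; apply: leq_trans (leq_add (leqnn _) e6) _; apply: eq_leq; ring.
(* Since t >= 3n, the non-trivial families are negligible against a single star. *)
have e9 : n * M * 2 ^ n + n + 1 <= 2 ^ t.
  apply: (@leq_trans (2 ^ (3 * n))); last by rewrite leq_exp2l.
  have nM : n * M <= 2 ^ n.-1 * 2 ^ n.-1 by apply: leq_mul.
  rewrite (_ : 3 * n = n.-1 + n.-1 + n + 2); last by lia.
  rewrite !expnD (_ : 2 ^ 2 = 4) //.
  have := leq_mul nM (leqnn (2 ^ n)).
  have : 2 ^ n * 1 <= 2 ^ n * (2 ^ n.-1 * 2 ^ n.-1).
    by rewrite leq_mul2l muln_gt0 expn_gt0 orbT.
  lia.
have e10 : I1 * 2 ^ n <= 2 ^ N.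
  apply: leq_trans e8 _; apply: leq_trans (leq_mul (leqnn _) e9) _.
  by rewrite /P -expnD subnK //; lia.
have nMP : P * (n + 1) <= 2 * (n * M * P).
  rewrite mulnC mulnA leq_mul2r; apply/orP; right.
  by have := leq_mul (leqnn n) M0; lia.
split.
- by rewrite mulnDl leq_add // leq_mul2r tl orbT.
- apply: (@leq_trans ((I0 + n ^ 2 * 2 ^ (2 * n + 2 + C2)) * 2 ^ n)).
    by rewrite leq_mul2r tg orbT.
  rewrite !mulnDl -[X in _ <= X]addnA leq_add2l.
  apply: leq_trans (leq_trans _ e5) (leq_trans e7 (leq_addl _ _)).
  by rewrite [n ^ 2 * _]mulnC.
- apply: leq_trans e8 _; apply: leq_trans (leq_add (leqnn _) nMP); apply: eq_leq; ring.
- apply: (@leq_trans ((I1 + n ^ 2 * 2 ^ (2 * n + 2 + C2)) * 2 ^ n)).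
    by rewrite leq_mul2r -mulnA ng orbT.
  rewrite mulnDl leq_add2l [n ^ 2 * _]mulnC; apply: leq_trans e5 _.
  by rewrite leq_pmull // muln_gt0 n0.
Qed.

Local Open Scope ring_scope.

(** * The choice of the parameter *)

(** From 1/(1+a) = 1 - a/(1+a) <= exp(-a/(1+a)). *)
Lemma expR_le_exprn (R : realType) (a : R) (m : nat) :
  0 <= a -> expR (m%:R * (a / (1 + a))) <= (1 + a) ^+ m.
Proof.
move=> a0; have p : 0 < 1 + a by lra.
rewrite expRM_natl; apply: lerXn2r; rewrite ?nnegrE ?expR_ge0 ?(ltW p) //.
have := expR_ge1Dx (- (a / (1 + a))); rewrite expRN.
have -> : 1 + - (a / (1 + a)) = (1 + a)^-1 by field; lra.
by rewrite lef_pV2 ?posrE ?expR_gt0.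
Qed.

(** (6/5)^(2q) >= exp(q/3), while 96 <= exp(95) and k^2 = exp(2L). *)
Lemma six_fifths_power (R : realType) (k q : nat) (L : R) :
  expR L = k%:R -> 95 + 2 * L <= q%:R / 3 ->
  (96 * k ^ 2 * 5 ^ (2 * q) <= 6 ^ (2 * q))%N.
Proof.
move=> kL qL; rewrite -(ler_nat R) (natrM _ (96 * k ^ 2)) (natrM _ 96) !natrX.
have five : 0 < (5 : R) ^+ (2 * q) by apply: exprn_gt0.
rewrite -ler_pdivlMr // -expr_div_n.
have -> : 6 / 5 = 1 + 5^-1 :> R by field.
apply: le_trans (expR_le_exprn (2 * q) _); last by rewrite invr_ge0.
have -> : (5^-1 / (1 + 5^-1) : R) = 6^-1 by field.
apply: (@le_trans _ _ (expR (95 + 2 * L))).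
  rewrite (expRD 95) expRM_natl kL; apply: ler_pM => //.
    by rewrite exprn_ge0.
  by apply: le_trans (expR_ge1Dx _); lra.
rewrite ler_expR (natrM _ 2 q); lra.
Qed.

(** (1 + 8q/k)^m >= exp(8qm/(k+8q)), while 16 <= exp(15) and k = exp(L). *)
Lemma density_power (R : realType) (k q m : nat) (L : R) :
  0 < k%:R :> R -> expR L = k%:R ->
  (15 + L) * (k%:R + 8 * q%:R) <= m%:R * (8 * q%:R) ->
  (16 * k * k ^ m <= (k + 8 * q) ^ m)%N.
Proof.
move=> k0 kL hL; have q0 : 0 <= q%:R :> R by [].
rewrite -(ler_nat R) (natrM _ (16 * k)) (natrM _ 16) !natrX (natrD _ k) (natrM _ 8 q).
have kp : 0 < (k%:R : R) ^+ m by apply: exprn_gt0.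
rewrite -ler_pdivlMr // -expr_div_n.
have -> : (k%:R + 8 * q%:R) / k%:R = 1 + 8 * q%:R / k%:R :> R by field; lra.
have a0 : 0 <= 8 * q%:R / k%:R :> R by apply: divr_ge0; lra.
apply: le_trans (expR_le_exprn _ a0).
have -> : 8 * q%:R / k%:R / (1 + 8 * q%:R / k%:R) = 8 * q%:R / (k%:R + 8 * q%:R) :> R.
  by field; apply/andP; split; lra.
apply: (@le_trans _ _ (expR (15 + L))).
  by rewrite (expRD 15) kL ler_pM2r //; apply: le_trans (expR_ge1Dx _); lra.
by rewrite ler_expR mulrA ler_pdivlMr //; lra.
Qed.

Lemma parameter_exists (R : realType) (k n : nat) :
  expR 6400 <= k%:R :> R ->
  2 * k%:R + 2 + 2 * Num.sqrt (k%:R * ln (k%:R : R)) <= n%:R ->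
  exists q : nat, [/\ (2 <= q)%N, (12 * q <= k)%N, (2 * k + 2 + 8 * q <= n)%N,
    (96 * k ^ 2 * 5 ^ (2 * q) <= 6 ^ (2 * q))%N &
    (16 * k * k ^ (3 * q - 2) <= (n - k) ^ (3 * q - 2))%N].
Proof.
move=> kbig; set L := ln _; set r := Num.sqrt _ => hn.
have k0 : 0 < k%:R :> R by apply: lt_le_trans kbig; apply: expR_gt0.
have kL : expR L = k%:R by apply: lnK; rewrite posrE.
have L0 : 6400 <= L by rewrite -ler_expR kL.
(* k = exp(L) >= (1+L/2)^2 >= L^2/4, and 6400/4 = 1600. As r^2 = kL, this places [r] between 40L and
   k/40. *)
have k1600 : 1600 * L <= k%:R.
  have := expR_ge1Dx (L / 2); have : expR L = expR (L / 2) * expR (L / 2).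
    by rewrite -expRD; congr expR; lra.
  rewrite kL => -> h.
  have : (1 + L / 2) * (1 + L / 2) <= expR (L / 2) * expR (L / 2) by apply: ler_pM => //; lra.
  nra.
have r0 : 0 <= r by apply: sqrtr_ge0.
have r2 : r * r = k%:R * L by rewrite -expr2 sqr_sqrtr // mulr_ge0 //; lra.
have r40 : 40 * L <= r by nra.
have rk : 40 * r <= k%:R by nra.
have /truncn_itv/andP[] : 0 <= r / 4 by lra.
set q := Num.truncn _; rewrite -[q.+1%:R]natr1 => q1 q2.
have L100 : 100 <= L by lra.
have q9 : 9 * L <= q%:R by lra.
clear L0 kbig.
have h8 : (2 * k + 2 + 8 * q <= n)%N.
  by rewrite -(ler_nat R) (natrD _ (2 * k + 2)) (natrD _ (2 * k)) (natrM _ 2 k) (natrM _ 8 q); lra.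
have h12 : (12 * q <= k)%N by rewrite -(ler_nat R) (natrM _ 12 q); lra.
have h2 : (2 <= q)%N by rewrite -(ler_nat R); lra.
exists q; split=> //; first by apply: (six_fifths_power kL); lra.
apply: (@leq_trans ((k + 8 * q) ^ (3 * q - 2))); last first.
  by case: (3 * q - 2)%N => // m; rewrite leq_exp2r //; clear -h8; lia.
apply: (density_power k0 kL).
rewrite natrB; last by clear -h2; lia.
rewrite (natrM _ 3 q).
(* To leading order the claim is kL <= 24q^2, where 24q^2 is about 3/2 r^2 = 3/2 kL; the percentages
   absorb the lower-order terms. *)
apply: (@le_trans _ _ (115 / 100 * L * (105 / 100 * k%:R))); first by apply: ler_pM; lra.
apply: (@le_trans _ _ (73 / 100 * r * (198 / 100 * r))); last by apply: ler_pM; lra.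
have -> : 73 / 100 * r * (198 / 100 * r) = 73 / 100 * (198 / 100) * (r * r) by ring.
by rewrite r2; nra.
Qed.

(** Division by [w * t] turns integer inequalities such as those of [counting_bounds] into an error
    of at most c/t. *)
Lemma ratio_close (R : realFieldType) (a w y c t eps : R) :
  0 < w -> 0 < t -> c <= eps * t ->
  a * t <= y * w * t + c * w -> y * w * t <= a * t + c * w ->
  `|a / w - y| <= eps.
Proof.
move=> w0 t0 ct up lo.
have -> : a / w - y = (a - y * w) / w by field; lra.
rewrite ler_norml ler_pdivlMr // ler_pdivrMr //.
rewrite -(ler_pM2r t0) -[X in _ && X](ler_pM2r t0).
have : c * w <= eps * t * w by rewrite ler_pM2r.
by move=> cw; apply/andP; split; lra.
Qed.

Unset Implicit Arguments.

Theorem theorem2 (R : realType) (eps : R) (eps_gt0 : 0 < eps) :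
  exists K : nat, forall k n : nat,
    (0 < k)%N -> (K <= k)%N ->
    2 * k%:R + 2 + 2 * Num.sqrt (k%:R * ln (k%:R : R)) <= n%:R ->
    `| (num_intersecting n k)%:R / 2 ^+ 'C(n - 1, k - 1) - n%:R | <= eps /\
    `| (num_intersecting_div_ge n k 1)%:R
       / (n%:R * ('C(n - 1, k))%:R
          * 2 ^+ ('C(n - 1, k - 1) - 'C(n - k - 1, k - 1))) - 1 | <= eps.
Proof.
have [K1 K1P] : exists K1 : nat, expR 6400 <= K1%:R :> R.
  exists (Num.truncn (expR 6400 : R)).+1.
  by have /truncn_itv/andP[_ /ltW] : 0 <= expR 6400 :> R by apply: expR_ge0.
have [K2 K2P] : exists K2 : nat, 2 / eps <= K2%:R.
  exists (Num.truncn (2 / eps)).+1.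
  by have /truncn_itv/andP[_ /ltW] : 0 <= 2 / eps by rewrite divr_ge0 // ltW.
(* [K1] serves the choice of [q]; [K2] gives 2/eps <= k <= n <= 2^n; 100 is demanded by the binomial
   estimates. *)
exists (100 + K1 + K2)%N => k n _ Kk hn.
have K1k : expR 6400 <= k%:R :> R.
  by apply: le_trans K1P _; rewrite ler_nat; move: Kk; clear; lia.
have [q [q2 qk kn big1 big2]] := parameter_exists K1k hn.
clear K1k K1P hn.
have k100 : (100 <= k)%N by lia.
have := counting_bounds k100 q2 qk kn big1 big2; rewrite !subn1 -subnS.
set N := 'C(n.-1, k.-1); set M := 'C(n.-1, k); set t := 'C(n - k.+1, k.-1) => /=.
move=> [b1 b2 b3 b4].
have T2 : 2 <= eps * 2 ^+ n.
  rewrite mulrC -ler_pdivrMr //; apply: le_trans K2P _.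
  rewrite -natrX ler_nat; apply: (@leq_trans n); first lia.
  by apply/ltnW/ltn_expl.
have toR a b : (a <= b)%N -> a%:R <= b%:R :> R by rewrite ler_nat.
move: (toR _ _ b1) (toR _ _ b2) (toR _ _ b3) (toR _ _ b4).
rewrite !natrD !natrM !natrX => r1 r2 r3 r4.
have T0 : 0 < 2 ^+ n :> R by apply: exprn_gt0.
split.
  apply: (@ratio_close _ _ _ _ 1 (2 ^+ n)) => //; [exact: exprn_gt0|lra|lra|lra].
have M0 : (0 < M)%N by rewrite bin_gt0; lia.
have n0 : (0 < n)%N by lia.
apply: (@ratio_close _ _ _ _ 2 (2 ^+ n)) => //.
- by rewrite !mulr_gt0 ?ltr0n ?exprn_gt0.
- lra.
- have : 0 <= n%:R * M%:R * 2 ^+ (N - t) :> R by rewrite !mulr_ge0 ?exprn_ge0.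
  lra.
Qed.
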